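(* Let $d\ge1$ be an integer and $r>0$. There are constants $C_1,C_2>0$ depending only on $r$ and $d$ such that the following holds. Let $p,N\ge 1$ be integers, let $\Omega\in\mathcal{F}_{d,p}$ (see context), with condition number $\kappa(\Omega)=\|\Omega\|\|\Omega^{-1}\|$, and let $Z_1,\dots,Z_N$ be i.i.d. centered Gaussian vectors indexed by the lattice $\mathcal{G}_{d,p}=\{1,\dots,p\}^d$ with precision operator $\Omega$ (i.e. covariance $\Sigma=\Omega^{-1}$). If $$N\ge C_1\left((\log N)^d+\log p+(\log\kappa(\Omega))^d\right),\qquad p>\log(N\kappa(\Omega)),$$ then the estimator $\widehat{\Omega}$ constructed in the context with block size $b=\lceil\log(N\kappa(\Omega))\rceil$ (a positive integer) satisfies, with probability at least $$1-2\left(\frac{\log(N\kappa(\Omega))}{p}\right)^{rd}e^{-(r+1)(\log N)^d},$$ that it is well defined and $$\frac{\|\widehat{\Omega}-\Omega\|}{\|\Omega\|}\le C_2\left(\sqrt{\frac{(\log N)^d}{N}}+\sqrt{\frac{\log p}{N}}+\sqrt{\frac{(\log\kappa(\Omega))^d}{N}}\right).$$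
   Context: $\mathcal{G}_{d,p}=[p]^d$ with $[p]=\{1,\dots,p\}$. Operators on the lattice are real matrices $A=(a(t,t'))_{t,t'\in\mathcal{G}_{d,p}}$, and $\|A\|$ is the $\ell_2(\mathcal{G}_{d,p})\to\ell_2(\mathcal{G}_{d,p})$ operator norm. $\log$ is the natural logarithm. With $\|t\|_1=\sum_i|t_i|$, $\|\mathbf{j}\|_\infty=\max_i|j_i|$, the class is $$\mathcal{F}_{d,p}=\Bigl\{\Omega=(\omega(t,t'))_{t,t'\in\mathcal{G}_{d,p}}:\ \Omega\succ0 \text{ (symmetric)},\ \sum_{t':\|t'-t\|_1\ge k}|\omega(t,t')|\le\|\Omega\|e^{-k}\ \ \forall k>0,\ \forall t\in\mathcal{G}_{d,p}\Bigr\}.$$ Construction of $\widehat{\Omega}$ with block size $b$ (a positive integer). Let $S=\lceil p/b\rceil$, $I_j=\{(j-1)b+1,\dots,jb\}$ for $1\le j\le S-1$, and $I_S=\{(S-1)b+1,\dots,p\}$. For $\mathbf{j}=(j_1,\dots,j_d)\in[S]^d$ let $B_{\mathbf{j}}=I_{j_1}\times\cdots\times I_{j_d}$. For an operator $A$ let $A_{\mathbf{j}\mathbf{j}'}=(a(t,t'))_{t\in B_{\mathbf{j}},t'\in B_{\mathbf{j}'}}$. Let $W_{\mathbf{j},2}=\bigcup_{\mathbf{j}'\in[S]^d:\|\mathbf{j}'-\mathbf{j}\|_\infty\le 2}B_{\mathbf{j}'}$. The local sample covariance is $\widehat{\Sigma}_{N_{\mathbf{j},2}}=(\widehat{\sigma}(t,t'))_{t,t'\in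 W_{\mathbf{j},2}}$ with $\widehat{\sigma}(t,t')=\frac1N\sum_{n=1}^N Z_n(t)Z_n(t')$. For $\|\mathbf{j}-\mathbf{j}'\|_\infty\le1$ the local estimator is $$T_{\mathbf{j}\mathbf{j}'}=\bigl((\widehat{\Sigma}_{N_{\mathbf{j},2}})^{-1}\bigr)_{\mathbf{j}\mathbf{j}'},$$ the restriction of $(\widehat{\Sigma}_{N_{\mathbf{j},2}})^{-1}$ to $B_{\mathbf{j}}\times B_{\mathbf{j}'}$ (defined when the matrix $\widehat{\Sigma}_{N_{\mathbf{j},2}}$ is invertible). Define $\widetilde{\Omega}$ blockwise by $\widetilde{\Omega}_{\mathbf{j}\mathbf{j}'}=T_{\mathbf{j}\mathbf{j}'}$ if $\|\mathbf{j}-\mathbf{j}'\|_\infty\le1$ and $0$ otherwise, and set $\widehat{\Omega}=\frac12(\widetilde{\Omega}+\widetilde{\Omega}^\top)$; it is well defined when all matrices $\widehat{\Sigma}_{N_{\mathbf{j},2}}$, $\mathbf{j}\in[S]^d$, are invertible. *)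

(* Defs.v *)
From HB Require Import structures.
From mathcomp Require Import all_boot all_order all_algebra.
From mathcomp Require Import all_classical all_reals all_analysis.

Set Implicit Arguments.
Unset Strict Implicit.
Unset Printing Implicit Defensive.

Import Order.TTheory GRing.Theory Num.Theory.
Local Open Scope ring_scope.

(* The lattice [p]^d, with coordinates shifted to {0, ..., p-1}; only
   differences of coordinates and the blocks below depend on the origin. *)
Definition lattice (d p : nat) : finType := {ffun 'I_d -> 'I_p}.

(* Operators on R^I for a finite index type I are matrices of size #|I|, the
   entry a(t, t') being A (enum_rank t) (enum_rank t'). *)
Notation operator R I := 'M[R]_#|{: I}|.

Definition entry (R : realType) (I : finType) (A : operator R I) (t t' : I) : R :=
  A (enum_rank t) (enum_rank t').

Definition l2norm (R : realType) (m : nat) (x : 'cV[R]_m) : R :=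
  Num.sqrt (\sum_(i < m) x i 0 ^+ 2).

Definition opnorm (R : realType) (m : nat) (A : 'M[R]_m) : R :=
  sup [set l2norm (A *m x) | x in [set x : 'cV[R]_m | l2norm x <= 1]]%classic.

Definition condition_number (R : realType) (m : nat) (A : 'M[R]_m) : R :=
  opnorm A * opnorm (invmx A).

Definition posdef (R : realType) (m : nat) (A : 'M[R]_m) : Prop :=
  A^T = A /\ forall x : 'cV[R]_m, x != 0 -> 0 < (x^T *m A *m x) 0 0.

Definition dist_l1 (d p : nat) (t t' : lattice d p) : nat :=
  (\sum_(i < d) `|(t i)%:Z - (t' i)%:Z|)%N.

Definition dist_linf (d p : nat) (t t' : lattice d p) : nat :=
  (\max_(i < d) `|(t i)%:Z - (t' i)%:Z|)%N.

Definition decay_class (R : realType) (d p : nat)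
    (Omega : operator R (lattice d p)) : Prop :=
  posdef Omega /\
  forall (k : R) (t : lattice d p), 0 < k ->
    \sum_(t' : lattice d p | k <= (dist_l1 t' t)%:R) `|entry Omega t t'|
      <= opnorm Omega * expR (- k).

(* Gaussian vector as a vector all of whose linear combinations are normal.
   The second parameter of normal_prob is the standard deviation; u = 0 is
   left out because normal_prob 0 0 is not the Dirac mass at 0. *)
Definition centered_gaussian (R : realType) (disp : measure_display)
    (T : measurableType disp) (P : probability T R) (I : finType)
    (Sigma : operator R I) (X : I -> {RV P >-> R}) : Prop :=
  forall u : 'cV[R]_#|{: I}|, u != 0 ->
  forall B : set R, measurable B ->
    P [set w | B (\sum_(t : I) u (enum_rank t) 0 * X t w)]%classic =
    normal_prob 0 (Num.sqrt ((u^T *m Sigma *m u) 0 0)) B.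

Definition cylinders (R : realType) (I : finType) : set (set (I -> R)) :=
  [set A | exists t : I, exists2 B : set R,
     measurable B & A = [set x | B (x t)]]%classic.

(* Since A n may be the whole space, the product rule for all of Z_1, ..., Z_N
   contains the product rule for every subfamily. *)
Definition independent_vectors (R : realType) (disp : measure_display)
    (T : measurableType disp) (P : probability T R) (I : finType) (N : nat)
    (Z : 'I_N -> I -> {RV P >-> R}) : Prop :=
  forall A : 'I_N -> set (I -> R),
    (forall n, <<s @cylinders R I >>%classic (A n)) ->
    P [set w | forall n, A n (fun t => Z n t w)]%classic =
    (\prod_(n < N) P [set w | A n (fun t => Z n t w)]%classic)%E.

Definition iid_gaussian (R : realType) (disp : measure_display)
    (T : measurableType disp) (P : probability T R) (I : finType) (N : nat)
    (Sigma : operator R I) (Z : 'I_N -> I -> {RV P >-> R}) : Prop :=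
  (forall n, centered_gaussian Sigma (Z n)) /\ independent_vectors Z.

(* ceil (p / b) for b > 0 *)
Definition nblocks (p b : nat) : nat := ((p + b.-1) %/ b)%N.

(* The last interval is cut at p by the type 'I_p. *)
Definition interval_block (p b : nat) (j : 'I_(nblocks p b)) : {set 'I_p} :=
  [set x : 'I_p | (j * b <= x < j.+1 * b)%N]%SET.

Definition block_index (d p b : nat) : finType := lattice d (nblocks p b).

Definition block (d p b : nat) (j : block_index d p b) : {set lattice d p} :=
  [set t : lattice d p | [forall i, t i \in interval_block (j i)]]%SET.

Definition window (d p b : nat) (j : block_index d p b) : {set lattice d p} :=
  (\bigcup_(j' : block_index d p b | (dist_linf j' j <= 2)%N) block j')%SET.

(* In what follows z n t is the observed value of Z_n(t). *)
Definition sample_cov (R : realType) (d p N : nat)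
    (z : 'I_N -> lattice d p -> R) (t t' : lattice d p) : R :=
  N%:R^-1 * \sum_(n < N) z n t * z n t'.

Definition local_cov (R : realType) (d p N b : nat)
    (z : 'I_N -> lattice d p -> R) (j : block_index d p b) :
    'M[R]_#|window j| :=
  \matrix_(a, c) sample_cov z (enum_val a) (enum_val c).

(* Entry (t, t') of a matrix indexed by W, and 0 if t or t' is not in W; each
   sum has at most one term. *)
Definition sub_entry (R : realType) (I : finType) (W : {set I})
    (M : 'M[R]_#|W|) (t t' : I) : R :=
  \sum_(a < #|W| | enum_val a == t) \sum_(c < #|W| | enum_val c == t') M a c.

(* The blocks partition the lattice, so for given (t, t') at most one pair
   (j, j') contributes. *)
Definition Omega_tilde (R : realType) (d p N b : nat)
    (z : 'I_N -> lattice d p -> R) : operator R (lattice d p) :=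
  \matrix_(a, c)
    \sum_(j : block_index d p b)
      \sum_(j' : block_index d p b | (dist_linf j j' <= 1)%N)
        if (enum_val a \in block j) && (enum_val c \in block j')
        then sub_entry (invmx (local_cov z j)) (enum_val a) (enum_val c)
        else 0.

Definition Omega_hat (R : realType) (d p N b : nat)
    (z : 'I_N -> lattice d p -> R) : operator R (lattice d p) :=
  2^-1 *: (Omega_tilde b z + (Omega_tilde b z)^T).

(* invmx is total (invmx A = A for singular A), so that Omega_hat is always
   a matrix, but it is the estimator only under this condition. *)
Definition well_defined (R : realType) (d p N b : nat)
    (z : 'I_N -> lattice d p -> R) : Prop :=
  forall j : block_index d p b, local_cov z j \in unitmx.

(* Main.v *)
(** Each local inverse has a bias and a random error.  With [Sigma = Omega^-1] and
    [G] the extension by zero of the inverse of [Sigma] restricted to a window,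
    [G Sigma] is the identity on vectors supported in the window; hence, for a
    vector [x] living on the blocks next to the central one, [(G - Omega) x] is,
    inside the window, [G Sigma] applied to the part of [Omega x] outside the
    window.  By the decay of [Omega] and the choice of the block size [b], this is
    at most [||Omega|| kappa e^-b <= ||Omega|| / N].
    For the random error, whiten the local covariance, so that for a unit vector
    the sample quadratic form is a normalized chi-square variable, for which the
    Chernoff bound holds; a union bound over a grid net of exponential cardinality
    in the size [w <= (5 b)^d] of the window and over the blocks gives
    [|x^T (S - A) x| <= e x^T A x] for all local covariances [A] and their samples
    [S], with [e] of the order of the rate of the theorem, and this passes to the
    inverses.  Since a block has at most [3^d] neighbours, the local errors add up
    to a bound on the operator norm. *)

Require Import Defs.
From HB Require Import structures.
From mathcomp Require Import all_boot all_order all_algebra.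
From mathcomp Require Import all_classical all_reals all_analysis.
From mathcomp Require Import measurable_realfun ring lra zify.

Set Implicit Arguments.
Unset Strict Implicit.
Unset Printing Implicit Defensive.

Import Order.TTheory GRing.Theory Num.Theory.
Local Open Scope ring_scope.

(** * Independence and chi-square tails *)

(** The random error is relative to the form of [A], not to the identity. An additive bound on the
    sample covariance would cost a factor kappa on inversion; but every principal submatrix of
    [Sigma] satisfies [|u|^2 <= ||Omega|| u^T A u], so a relative error [e] becomes an error of
    order [e ||Omega||] on the inverse. Hence kappa acts only through the bias, which the choice of
    [b] cancels at the price of a logarithm. Errors are stated as [y^T M x <= K (|y|^2 + |x|^2)]:
    squared norms of the pieces of a vector add up, so the number of blocks never enters the norm
    bound, only the union bound. The net needs a cardinality exponential in [w] without a factor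
    [log w] in the exponent, which the rate could not absorb; this is why it is a part of a grid
    counted with weights. The first two terms of the rate come with [N >= e] and [N > 1], which the
    hypothesis on [N] must supply: constants are absorbed into [(log N)^d >= 1]. *)

Section measurability.
Context d (T : measurableType d) (R : realType) (I : finType) (Q : pred I).

Lemma measurable_fun_sum (h : I -> T -> R) :
  (forall i, measurable_fun setT (h i)) ->
  measurable_fun setT (fun w => \sum_(i | Q i) h i w).
Proof.
move=> mh; under eq_fun do rewrite -big_filter.
exact: measurable_sum.
Qed.

Lemma measurable_fun_prod (h : I -> T -> R) :
  (forall i, measurable_fun setT (h i)) ->
  measurable_fun setT (fun w => \prod_(i | Q i) h i w).
Proof.
move=> mh; under eq_fun do rewrite -big_filter.
exact: measurable_prod.
Qed.

End measurability.

Section independence.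
Local Open Scope classical_set_scope.
Import HBNNSimple.

(** Level sets reduce simple functions to indicators, and monotone convergence does the rest. The
    weight [g] lets one statement serve for a density ([g] the pdf), an image law ([g = 1]) and a
    product of independent factors ([g] the remaining ones). *)
Lemma integral_product_ext d (T : measurableType d) d' (U : measurableType d')
    (R : realType) (mu : {measure set T -> \bar R}) (Q : {measure set U -> \bar R})
    (Y : T -> U) (g : T -> R) (c : R) (f : U -> R) :
  measurable_fun setT Y -> measurable_fun setT g -> (forall w, 0 <= g w) ->
  0 <= c ->
  (forall B, measurable B ->
    \int[mu]_w (\1_B (Y w) * g w)%:E = c%:E * Q B)%E ->
  measurable_fun setT f -> (forall y, 0 <= f y) ->
  (\int[mu]_w (f (Y w) * g w)%:E = c%:E * \int[Q]_y (f y)%:E)%E.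
Proof.
move=> mY mg g0 c0 H mf f0.
have mEf : measurable_fun setT (fun y : U => (f y)%:E) by exact/measurable_EFinP.
have Ef0 y : (0 <= (f y)%:E)%E by rewrite lee_fin.
pose h := nnsfun_approx measurableT mEf.
have cvh y : (h n y)%:E @[n --> \oo] --> (f y)%:E.
  exact: (cvg_nnsfun_approx measurableT mEf (fun x _ => Ef0 x) (x := y)).
have mhY n : measurable_fun setT (fun w => h n (Y w) * g w).
  apply: measurable_funM => //; apply: measurableT_comp => //.
have -> : (\int[mu]_w (f (Y w) * g w)%:E =
    limn (fun n => \int[mu]_w (h n (Y w) * g w)%:E))%E.
  rewrite -monotone_convergence //=; first last.
  - move=> w _ a b ab; rewrite lee_fin ler_wpM2r//.
    exact/lefP/nd_nnsfun_approx.
  - by move=> n w _; rewrite lee_fin mulr_ge0.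
  - by move=> n; apply/measurable_EFinP.
  apply: eq_integral => w _; apply/esym/cvg_lim => //.
  under eq_fun do rewrite EFinM.
  by rewrite EFinM; apply: cvgeZr => //; exact: cvh.
have -> : (\int[Q]_y (f y)%:E = limn (fun n => \int[Q]_y (h n y)%:E))%E.
  rewrite -monotone_convergence //=; first last.
  - by move=> w _ a b ab; rewrite lee_fin; exact/lefP/nd_nnsfun_approx.
  - by move=> n w _; rewrite lee_fin.
  - by move=> n; apply/measurable_EFinP.
  by apply: eq_integral => w _; apply/esym/cvg_lim => //; exact: cvh.
have cvQ : cvgn (fun n => \int[Q]_y (h n y)%:E)%E.
  apply: ereal_nondecreasing_is_cvgn => a b ab; apply: ge0_le_integral => //=.
  - by move=> w _; rewrite lee_fin.
  - by apply/measurable_EFinP.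
  - by apply/measurable_EFinP.
  - by move=> w _; rewrite lee_fin; exact/lefP/nd_nnsfun_approx.
rewrite -limeMl//; congr (limn _); apply/funext => n.
transitivity (\int[mu]_w \sum_(r \in range (h n))
    (r * (\1_(h n @^-1` [set r]) (Y w) * g w))%:E)%E.
  apply: eq_integral => w _; rewrite (fimfunE (h n) (Y w)) fsumEFin//.
  congr EFin; rewrite !fsbig_finite//= mulr_suml; apply: eq_bigr => r _.
  by rewrite mulrA.
have mi r : measurable_fun setT (fun w => \1_(h n @^-1` [set r]) (Y w) * g w).
  apply: measurable_funM => //; apply: measurableT_comp => //.
have i0 r w : 0 <= \1_(h n @^-1` [set r]) (Y w) * g w by rewrite mulr_ge0.
have r0 r w : 0 <= r * (\1_(h n @^-1` [set r]) (Y w) * g w).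
  rewrite mulrA mulr_ge0//.
  by have := nnfun_muleindic_ge0 (h n) r (Y w); rewrite -EFinM lee_fin.
rewrite ge0_integral_fsum//; last 2 first.
- by move=> r; apply/measurable_EFinP/measurable_funM.
- by move=> r w _; rewrite lee_fin.
rewrite integralT_nnsfun sintegralE.
rewrite !fsbig_finite//= ge0_sume_distrr; last first.
  move=> r _; exact: nnsfun_mulemu_ge0.
apply: eq_bigr => r _.
have [r0'|r0'] := leP 0 r.
  under eq_integral do rewrite EFinM.
  rewrite ge0_integralZl//.
  - by rewrite H// muleCA.
  - exact/measurable_EFinP.
  - by move=> w _; rewrite lee_fin.
(* A negative level is not attained, so both sides vanish. *)
rewrite preimage_nnfun0// measure0 !mule0.
by apply: integral0_eq => w _; rewrite indic0 mul0r mulr0.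
Qed.

End independence.
Section independence_product.
Local Open Scope classical_set_scope.

Lemma integral_prod_independent d (T : measurableType d) (R : realType)
    (P : probability T R) N (Y : 'I_N -> {RV P >-> R}) :
  (forall B : 'I_N -> set R, (forall n, measurable (B n)) ->
    P [set w | forall n, B n (Y n w)] = \prod_(n < N) P (Y n @^-1` B n))%E ->
  forall (F : 'I_N -> R -> R) (e : 'I_N -> R),
  (forall n, measurable_fun setT (F n)) -> (forall n y, 0 <= F n y) ->
  (forall n, \int[P]_w (F n (Y n w))%:E = (e n)%:E)%E ->
  (\int[P]_w (\prod_(n < N) F n (Y n w))%:E = (\prod_(n < N) e n)%:E)%E.
Proof.
move=> indep.
(* Replace indicators by general functions one coordinate at a time. *)
suff main k : forall (F : 'I_N -> R -> R) (e : 'I_N -> R),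
    (forall n, measurable_fun setT (F n)) -> (forall n y, 0 <= F n y) ->
    (forall n, \int[P]_w (F n (Y n w))%:E = (e n)%:E)%E ->
    (forall n : 'I_N, (k <= n)%N -> exists2 B, measurable B & F n = \1_B) ->
    (\int[P]_w (\prod_(n < N) F n (Y n w))%:E = (\prod_(n < N) e n)%:E)%E.
  move=> F e mF F0 Fe; apply: (main N) => // n.
  by rewrite leqNgt ltn_ord.
elim: k => [|k IH] F e mF F0 Fe Find.
  have /choice[B HB] n : exists B, measurable B /\ F n = \1_B.
    by have [B mB FB] := Find n (leq0n n); exists B.
  have mB n : measurable (B n) by have [] := HB n.
  have FB n : F n = \1_(B n) by have [] := HB n.
  transitivity (\int[P]_w (\1_[set w | forall n, B n (Y n w)] w)%:E)%E.
    apply: eq_integral => w _; congr EFin.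
    under eq_bigr do rewrite FB.
    rewrite [RHS]indicE; have [h|h] := pselect (forall n, B n (Y n w)).
      by rewrite mem_set// big1// => n _; rewrite indicE mem_set.
    rewrite memNset//; move/existsNP: h => [n Bn].
    by rewrite (bigD1 n)//= indicE memNset// mul0r.
  have mI : measurable [set w | forall n, B n (Y n w)].
    have -> : [set w | forall n, B n (Y n w)] =
        \bigcap_(n in [set: 'I_N]) (Y n @^-1` B n).
      by apply/seteqP; split => w /= h n; [move=> _; exact: h | exact: (h n Logic.I)].
    apply: fin_bigcap_measurable => // n _.
    by exact: measurable_funPTI.
  rewrite integral_indic// setIT; apply: (eq_trans (indep B mB)).
  rewrite -prodEFin.
  apply: eq_bigr => n _; rewrite -Fe FB.
  transitivity (\int[P]_w (\1_(Y n @^-1` B n) w)%:E)%E => //.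
  rewrite integral_indic ?setIT//.
  by exact: measurable_funPTI.
have [Nk|kN] := leqP N k.
  by apply: IH => // n kn; have := ltn_ord n; rewrite ltnNge (leq_trans Nk).
pose i := Ordinal kN.
have e0 n : 0 <= e n.
  by rewrite -lee_fin -Fe; apply: integral_ge0 => w _; rewrite lee_fin.
transitivity (\int[P]_w (F i (Y i w) *
    \prod_(n < N | n != i) F n (Y n w))%:E)%E.
  by apply: eq_integral => w _; rewrite (bigD1 i).
(* Only indicators in coordinate [i] have to be treated, the other factors being the weight; this is
   the induction hypothesis with [F i] replaced by [\1_B]. *)
rewrite (@integral_product_ext _ _ _ _ _ P (distribution P (Y i)) (Y i) _
  (\prod_(n < N | n != i) e n))//.
- rewrite ge0_integral_distribution//=; last 2 first.
  + exact/measurable_EFinP.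
  + by move=> y; rewrite lee_fin.
  by rewrite Fe -EFinM [in RHS](bigD1 i)//= mulrC.
- by apply: measurable_fun_prod => n; exact: measurableT_comp.
- by move=> w; apply: prodr_ge0.
- by apply: prodr_ge0.
move=> B mB.
have := IH (fun n => if n == i then \1_B else F n)
  (fun n => if n == i then fine (P (Y i @^-1` B)) else e n).
have mYB : measurable (Y i @^-1` B).
  by exact: measurable_funPTI.
rewrite (bigD1 i)//= eqxx => IH'.
transitivity (\int[P]_w (\prod_(n < N) (if n == i then \1_B else F n) (Y n w))%:E)%E.
  apply: eq_integral => w _; rewrite [in RHS](bigD1 i)//= eqxx; congr (_ * _)%:E.
  by apply: eq_bigr => n /negbTE ->.
rewrite IH'.
- rewrite EFinM muleC fineK ?fin_num_measure//; congr (_ * _)%E.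
  by congr EFin; apply: eq_bigr => n /negbTE ->.
- by move=> n; case: eqP.
- by move=> n y; case: eqP.
- move=> n; case: eqP => [->|//].
  rewrite fineK ?fin_num_measure//.
  transitivity (\int[P]_w (\1_(Y i @^-1` B) w)%:E)%E => //.
  by rewrite integral_indic ?setIT.
- move=> n kn; case: eqP => [_|ni]; first by exists B.
  apply: Find; rewrite ltn_neqAle kn andbT.
  by apply/eqP => kE; apply: ni; apply/val_inj.
Qed.

End independence_product.
Section chi_square.
Local Open Scope classical_set_scope.
Context (R : realType).

Lemma integral_normal_prob (s : R) (f : R -> R) :
  measurable_fun setT f -> (forall y, 0 <= f y) ->
  (\int[normal_prob 0 s]_y (f y)%:E =
   \int[lebesgue_measure]_y (f y * normal_pdf 0 s y)%:E)%E.
Proof.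
move=> mf f0; rewrite (@integral_product_ext _ _ _ _ _ lebesgue_measure
  (normal_prob 0 s) id (normal_pdf 0 s) 1)//; first by rewrite mul1e.
- exact: measurable_normal_pdf.
- by move=> w; exact: normal_pdf_ge0.
move=> B mB; rewrite mul1e /normal_prob [RHS]integral_mkcond.
apply: eq_integral => y _; rewrite patchE indicE.
by case: ifP => _; rewrite ?mul1r ?mul0r.
Qed.

Lemma sqrtr_div (a b : R) : 0 <= a -> 0 <= b ->
  Num.sqrt (a / b) = Num.sqrt a / Num.sqrt b.
Proof. by move=> a0 b0; rewrite sqrtrM// sqrtrV. Qed.

Lemma centered_normal_pdfE (s y : R) : s != 0 ->
  normal_pdf 0 s y =
  (Num.sqrt (s ^+ 2 * pi *+ 2))^-1 * expR (- y ^+ 2 / (s ^+ 2 *+ 2)).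
Proof.
have -> : expR (- y ^+ 2 / (s ^+ 2 *+ 2)) = normal_fun 0 s y.
  by rewrite /normal_fun subr0.
by move=> s0; rewrite normal_pdfE.
Qed.

(** Tilting the density of deviation [s] by [expR (l * y ^+ 2 / s ^+ 2)] gives, up to the factor
    [1 / sqrt (1 - 2 l)], the density of deviation [s / sqrt (1 - 2 l)], of mass 1. *)
Lemma normal_prob_expR_sqr (s l : R) : 0 < s -> l < 2^-1 ->
  (\int[normal_prob 0 s]_y (expR (l * (y ^+ 2 / s ^+ 2 - 1)))%:E =
   (expR (- l) / Num.sqrt (1 - 2 * l))%:E)%E.
Proof.
move=> s0 l2.
have q0 : 0 < 1 - 2 * l by lra.
have r0 : 0 < Num.sqrt (1 - 2 * l) by rewrite sqrtr_gt0.
have s'0 : s / Num.sqrt (1 - 2 * l) != 0 by rewrite gt_eqF// divr_gt0.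
rewrite integral_normal_prob; last 2 first.
- apply: measurableT_comp => //; apply: measurable_funM => //.
  by apply: measurable_funB => //; exact: measurable_funM.
- by move=> y; exact: expR_ge0.
transitivity (\int[lebesgue_measure]_y
    ((expR (- l) / Num.sqrt (1 - 2 * l))%:E *
     (normal_pdf 0 (s / Num.sqrt (1 - 2 * l)) y)%:E))%E.
  apply: eq_integral => y _; rewrite -EFinM; congr EFin.
  rewrite !centered_normal_pdfE ?gt_eqF ?divr_gt0//.
  rewrite expr_div_n sqr_sqrtr ?(ltW q0)//.
  have -> : s ^+ 2 / (1 - 2 * l) * pi *+ 2 = (s ^+ 2 * pi *+ 2) / (1 - 2 * l).
    by rewrite -mulrnAr -mulrnAr mulrAC.
  rewrite sqrtr_div ?mulrn_wge0 ?mulr_ge0 ?pi_ge0 ?(ltW s0) ?(ltW q0)//.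
  have k0 : 0 < Num.sqrt (s ^+ 2 * pi *+ 2).
    by rewrite sqrtr_gt0 pmulrn_lgt0// mulr_gt0 ?pi_gt0// exprn_gt0.
  rewrite invf_div mulrCA -expRD.
  set k := Num.sqrt (s ^+ 2 * pi *+ 2) in k0 *.
  set q := Num.sqrt (1 - 2 * l) in r0 *.
  set e := expR (- y ^+ 2 / _).
  have -> : expR (- l) / q * (q / k * e) = k^-1 * (expR (- l) * e).
    by field; rewrite !gt_eqF.
  rewrite /e -expRD; congr (_ * expR _).
  by field; rewrite !gt_eqF.
apply: (@etrans _ _ ((expR (- l) / Num.sqrt (1 - 2 * l))%:E *
    \int[lebesgue_measure]_y (normal_pdf 0 (s / Num.sqrt (1 - 2 * l)) y)%:E)%E).
  apply: ge0_integralZl => //.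
  - by apply/measurable_EFinP; exact: measurable_normal_pdf.
  - by move=> y _; rewrite lee_fin normal_pdf_ge0.
by rewrite integral_normal_pdf mule1.
Qed.

(** Reduces to [expR (- (2 l + 8 l^2)) <= 1 - 2 l], a consequence of [1 + x <= expR x] and of [(1 -
    2 l) (1 + 2 l + 8 l^2) = 1 + 4 l^2 (1 - 4 l)]. Negative [l] are included, for the lower tail. *)
Lemma expR_div_sqrt_le (l : R) : l <= 4^-1 ->
  expR (- l) / Num.sqrt (1 - 2 * l) <= expR (4 * l ^+ 2).
Proof.
move=> l4; have q0 : 0 < 1 - 2 * l by lra.
have r0 : 0 < Num.sqrt (1 - 2 * l) by rewrite sqrtr_gt0.
have e0 : 0 < expR (2 * l + 8 * l ^+ 2) by exact: expR_gt0.
have key : expR (- (2 * l + 8 * l ^+ 2)) <= 1 - 2 * l.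
  rewrite expRN -[leLHS]mul1r ler_pdivrMr//.
  apply: le_trans (ler_wpM2l (ltW q0) (expR_ge1Dx (2 * l + 8 * l ^+ 2))).
  have : 0 <= l ^+ 2 * (1 - 4 * l) by rewrite mulr_ge0 ?sqr_ge0//; lra.
  nra.
rewrite ler_pdivrMr// mulrC -ler_pdivrMr ?expR_gt0// -expRN -expRD.
rewrite -[leLHS](ger0_norm (expR_ge0 _)) -sqrtr_sqr ler_sqrt ?(ltW q0)//.
by rewrite expr2 -expRD; apply: le_trans key; rewrite ler_expR; lra.
Qed.

End chi_square.
Lemma integral_normal_law d (T : measurableType d) (R : realType)
   (P : probability T R) (Y : {RV P >-> R}) (s : R) (f : R -> R) :
  (forall B : set R, measurable B ->
    P (Y @^-1` B)%classic = normal_prob 0 s B) ->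
  measurable_fun setT f -> (forall y, 0 <= f y) ->
  (\int[P]_w (f (Y w))%:E = \int[normal_prob 0 s]_y (f y)%:E)%E.
Proof.
move=> law mf f0; rewrite -[RHS]mul1e.
(* [normal_prob] lives on [measurableTypeR R], which has the Borel sets of [R]
   but another display *)
rewrite -(@integral_product_ext _ _ _ (measurableTypeR R) R P (normal_prob 0 s)
  Y (cst 1) 1 f)//.
- by apply: eq_integral => w _; rewrite mulr1.
- exact: (@measurable_funPT _ _ _ _ Y).
move=> B mB; under eq_integral do rewrite mulr1.
rewrite mul1e; apply: etrans (law _ mB).
transitivity (\int[P]_w (\1_(Y @^-1` B)%classic w)%:E)%E => //.
by rewrite integral_indic ?setIT//; exact: (@measurable_funPTI _ _ _ _ Y).
Qed.

Section chi_square_tail.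
Local Open Scope classical_set_scope.
Context d (T : measurableType d) (R : realType) (P : probability T R).
Context (N : nat) (Y : 'I_N -> {RV P >-> R}) (s : R).
Hypothesis s0 : 0 < s.
Hypothesis indep : forall B : 'I_N -> set R, (forall n, measurable (B n)) ->
  (P [set w | forall n, B n (Y n w)] = \prod_(n < N) P (Y n @^-1` B n))%E.
Hypothesis law : forall n (B : set R), measurable B ->
  P (Y n @^-1` B) = normal_prob 0 s B.

(** Chernoff's method: Markov's inequality for the exponential, whose expectation factors by
    independence. *)
Lemma chi_square_exp_tail (l a : R) : l <= 4^-1 ->
  (P [set w | (a <= l * \sum_(n < N) (Y n w ^+ 2 / s ^+ 2 - 1))%R] <=
   (expR (N%:R * (4 * l ^+ 2) - a))%:E)%E.
Proof.
move=> l4; pose F (y : R) := expR (l * (y ^+ 2 / s ^+ 2 - 1)).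
have mF : measurable_fun setT F.
  apply: measurableT_comp => //; apply: measurable_funM => //.
  by apply: measurable_funB => //; apply: measurable_funM.
have intF n : (\int[P]_w (F (Y n w))%:E =
    (expR (- l) / Num.sqrt (1 - 2 * l))%:E)%E.
  rewrite -(normal_prob_expR_sqr s0); last by lra.
  apply: (integral_normal_law (law n) mF) => y.
  exact: expR_ge0.
have mS : measurable_fun setT
    (fun w => l * \sum_(n < N) (Y n w ^+ 2 / s ^+ 2 - 1)).
  apply: measurable_funM => //; apply: measurable_fun_sum => n.
  apply: measurable_funB => //; apply: measurable_funM => //.
  exact: measurable_funX.
set A := [set w | _].
have mA : measurable A.
  by rewrite -[A]setTI; exact: measurable_fun_le.
have intP : (\int[P]_w (\prod_(n < N) F (Y n w))%:E <=
    (expR (N%:R * (4 * l ^+ 2)))%:E)%E.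
  rewrite (@integral_prod_independent _ _ _ _ _ _ indep (fun=> F)
    (fun=> expR (- l) / Num.sqrt (1 - 2 * l)))//; last first.
    by move=> n y; exact: expR_ge0.
  rewrite lee_fin expRM_natl.
  rewrite -[X in _ <= _ ^+ X](card_ord N) -prodr_const; apply: ler_prod => n _.
  by rewrite divr_ge0 ?expR_ge0 ?sqrtr_ge0//= expR_div_sqrt_le.
have mP : measurable_fun setT (fun w => \prod_(n < N) F (Y n w)).
  by apply: measurable_fun_prod => n; exact: measurableT_comp.
have P0 w : 0 <= \prod_(n < N) F (Y n w).
  by apply: prodr_ge0 => n _; exact: expR_ge0.
rewrite -[A]setIT -integral_indic//.
apply: (@le_trans _ _ (\int[P]_w ((expR (- a))%:E * (\prod_(n < N) F (Y n w))%:E))%E).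
  apply: ge0_le_integral => //.
  - exact/measurable_EFinP/measurable_indic.
  - exact/measurable_EFinP/measurable_funM.
  move=> w _; rewrite -EFinM lee_fin -expR_sum -mulr_sumr -expRD.
  rewrite indicE; have [/set_mem|_] := boolP (w \in A); last exact: expR_ge0.
  by rewrite /A /= => aw; rewrite -[leLHS]expR0 ler_expR addrC subr_ge0.
rewrite ge0_integralZl//; last 2 first.
- exact/measurable_EFinP.
- by move=> w _; rewrite lee_fin.
rewrite addrC expRD EFinM.
by apply: lee_wpmul2l; rewrite ?lee_fin ?expR_ge0.
Qed.

Lemma chi_square_tail (t : R) : 0 <= t -> t <= 2 ->
  (P [set w | (N%:R * t <= `|\sum_(n < N) (Y n w ^+ 2 / s ^+ 2 - 1)|)%R] <=
   (2 * expR (- (N%:R * t ^+ 2 / 16)))%:E)%E.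
Proof.
move=> t0 t2; pose S w := \sum_(n < N) (Y n w ^+ 2 / s ^+ 2 - 1).
have mS : measurable_fun setT S.
  apply: measurable_fun_sum => n.
  apply: measurable_funB => //; apply: measurable_funM => //.
  exact: measurable_funX.
(* The value [l = t / 8] minimizes [4 N l^2 - N t l], with minimum [- N t^2 / 16]; [t <= 2] keeps it
   below 1/4. *)
pose A (l : R) := [set w | N%:R * t * (t / 8) <= l * S w].
have mA l : measurable (A l).
  rewrite -[A l]setTI; apply: measurable_fun_le => //.
  exact: measurable_funM.
have PA l : l ^+ 2 = (t / 8) ^+ 2 -> l <= 4^-1 ->
    (P (A l) <= (expR (- (N%:R * t ^+ 2 / 16)))%:E)%E.
  move=> lt l4; apply: (le_trans (chi_square_exp_tail _ l4)).
  rewrite lee_fin ler_expR lt; lra.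
apply: (@le_trans _ _ (P (A (t / 8) `|` A (- (t / 8))))).
  apply: le_measure; rewrite ?inE.
  - rewrite -[X in measurable X]setTI; apply: measurable_fun_le => //.
    exact: measurableT_comp.
  - exact: measurableU.
  move=> w /=; rewrite ler_normr => /orP[h|h]; [left|right]; rewrite /A /=.
    by rewrite mulrC ler_wpM2l//; lra.
  by rewrite mulNr -mulrN mulrC ler_wpM2l//; lra.
apply: (le_trans (measureU2 _ _ _)) => //.
rewrite mulr_natl mulr2n EFinD; apply: leeD; by apply: PA => //; lra.
Qed.

End chi_square_tail.
(** * Operator norm and positive definite matrices *)

Section inner_product.
Context (R : realType).

Definition dotp m (x y : 'cV[R]_m) : R := \sum_(i < m) x i 0 * y i 0.

Definition nsq m (x : 'cV[R]_m) : R := dotp x x.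

Lemma dotpE m (x y : 'cV[R]_m) : dotp x y = (x^T *m y) 0 0.
Proof. by rewrite mxE; apply: eq_bigr => i _; rewrite mxE. Qed.

Lemma dotpC m (x y : 'cV[R]_m) : dotp x y = dotp y x.
Proof. by apply: eq_bigr => i _; rewrite mulrC. Qed.

Lemma dotpDr m (x y z : 'cV[R]_m) : dotp x (y + z) = dotp x y + dotp x z.
Proof. by rewrite -big_split; apply: eq_bigr => i _; rewrite mxE mulrDr. Qed.

Lemma dotpDl m (x y z : 'cV[R]_m) : dotp (y + z) x = dotp y x + dotp z x.
Proof. by rewrite dotpC dotpDr !(dotpC x). Qed.

Lemma dotpZr m a (x y : 'cV[R]_m) : dotp x (a *: y) = a * dotp x y.
Proof. by rewrite mulr_sumr; apply: eq_bigr => i _; rewrite mxE mulrCA. Qed.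

Lemma dotpZl m a (x y : 'cV[R]_m) : dotp (a *: x) y = a * dotp x y.
Proof. by rewrite dotpC dotpZr dotpC. Qed.

Lemma dotpNr m (x y : 'cV[R]_m) : dotp x (- y) = - dotp x y.
Proof. by rewrite -scaleN1r dotpZr mulN1r. Qed.

Lemma dotpNl m (x y : 'cV[R]_m) : dotp (- x) y = - dotp x y.
Proof. by rewrite dotpC dotpNr dotpC. Qed.

Lemma dotpBr m (x y z : 'cV[R]_m) : dotp x (y - z) = dotp x y - dotp x z.
Proof. by rewrite dotpDr dotpNr. Qed.

Lemma dotpBl m (x y z : 'cV[R]_m) : dotp (y - z) x = dotp y x - dotp z x.
Proof. by rewrite dotpDl dotpNl. Qed.

Lemma dotp0r m (x : 'cV[R]_m) : dotp x 0 = 0.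
Proof. by rewrite -(scale0r 0) dotpZr mul0r. Qed.

Lemma dotp_sumr m (I : finType) (Q : pred I) (x : 'cV[R]_m) (y : I -> 'cV[R]_m) :
  dotp x (\sum_(i | Q i) y i) = \sum_(i | Q i) dotp x (y i).
Proof. by apply: big_morph => [u v|]; rewrite ?dotpDr ?dotp0r. Qed.

Lemma dotp_mulmx m n (A : 'M[R]_(m, n)) x y :
  dotp (A *m x) y = dotp x (A^T *m y).
Proof. by rewrite !dotpE trmx_mul mulmxA. Qed.

Lemma nsqE m (x : 'cV[R]_m) : nsq x = \sum_(i < m) x i 0 ^+ 2.
Proof. by []. Qed.

Lemma nsq_ge0 m (x : 'cV[R]_m) : 0 <= nsq x.
Proof. by rewrite nsqE sumr_ge0// => i _; exact: sqr_ge0. Qed.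

Lemma nsq_eq0 m (x : 'cV[R]_m) : (nsq x == 0) = (x == 0).
Proof.
apply/eqP/eqP => [h|->]; last by rewrite /nsq dotp0r.
apply/colP => i; rewrite mxE; apply/eqP; rewrite -sqrf_eq0; apply/eqP.
move: h; rewrite nsqE => /psumr_eq0P; apply => // j _; exact: sqr_ge0.
Qed.

Lemma nsqZ m a (x : 'cV[R]_m) : nsq (a *: x) = a ^+ 2 * nsq x.
Proof. by rewrite /nsq dotpZl dotpZr mulrA. Qed.

Lemma nsqN m (x : 'cV[R]_m) : nsq (- x) = nsq x.
Proof. by rewrite /nsq dotpNl dotpNr opprK. Qed.

Lemma nsqB m (x y : 'cV[R]_m) : nsq (x - y) = nsq x - 2 * dotp x y + nsq y.
Proof. by rewrite /nsq dotpBl !dotpBr (dotpC y x); ring. Qed.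

Lemma nsqD m (x y : 'cV[R]_m) : nsq (x + y) = nsq x + 2 * dotp x y + nsq y.
Proof. by rewrite /nsq dotpDl !dotpDr (dotpC y x); ring. Qed.

Lemma dotp_le m (x y : 'cV[R]_m) : 2 * dotp x y <= nsq x + nsq y.
Proof. by have := nsq_ge0 (x - y); rewrite nsqB; lra. Qed.

Lemma dotp_leM m (c : R) (x y : 'cV[R]_m) : 0 < c ->
  2 * dotp x y <= c * nsq x + c^-1 * nsq y.
Proof.
move=> c0; have := nsq_ge0 (c *: x - y); rewrite nsqB nsqZ dotpZl => h.
rewrite -(ler_pM2l c0) mulrDr (mulrA c c^-1) mulfV ?gt_eqF//; lra.
Qed.

Lemma dotp_sqr_le m (x y : 'cV[R]_m) : dotp x y ^+ 2 <= nsq x * nsq y.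
Proof.
have [/eqP|y0] := boolP (y == 0).
  by move=> ->; rewrite /nsq !dotp0r mulr0 expr0n.
have ny : 0 < nsq y by rewrite lt_neqAle nsq_ge0 eq_sym nsq_eq0 y0.
have := nsq_ge0 (nsq y *: x - dotp x y *: y).
rewrite nsqB !nsqZ dotpZl dotpZr => h.
rewrite -(ler_pM2l ny); lra.
Qed.

Lemma l2normE m (x : 'cV[R]_m) : l2norm x = Num.sqrt (nsq x).
Proof. by []. Qed.

End inner_product.

Section operator_norm.
Context (R : realType).
Local Open Scope classical_set_scope.

Lemma nsq_mulmx_frobenius m (A : 'M[R]_m) x :
  nsq (A *m x) <= (\sum_i nsq (row i A)^T) * nsq x.
Proof.
rewrite nsqE mulr_suml; apply: ler_sum => i _.
suff -> : (A *m x) i 0 = dotp (row i A)^T x by exact: dotp_sqr_le.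
by rewrite mxE; apply: eq_bigr => j _; rewrite !mxE.
Qed.

(** [sup] takes a default value on unbounded sets, so this precedes any use of [opnorm]; the
    Frobenius norm is an upper bound. *)
Lemma opnorm_has_sup m (A : 'M[R]_m) :
  has_sup [set l2norm (A *m x) | x in [set x : 'cV[R]_m | l2norm x <= 1]].
Proof.
split.
  exists (l2norm (A *m 0)); exists 0 => //=.
  by rewrite l2normE /nsq dotp0r sqrtr0.
exists (Num.sqrt (\sum_i nsq (row i A)^T)) => _ [x /= x1 <-].
rewrite l2normE ler_sqrt; last first.
  by apply: sumr_ge0 => i _; exact: nsq_ge0.
apply: le_trans (nsq_mulmx_frobenius A x) _.
apply: ler_piMr; first by apply: sumr_ge0 => i _; exact: nsq_ge0.
by move: x1; rewrite l2normE -[1 in X in X -> _]sqrtr1 ler_sqrt.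
Qed.

Lemma opnorm_ge0 m (A : 'M[R]_m) : 0 <= opnorm A.
Proof.
have [_ ub] := opnorm_has_sup A.
apply: le_trans (ub_le_sup ub _); last first.
  by exists 0 => //=; rewrite l2normE /nsq dotp0r sqrtr0.
by rewrite sqrtr_ge0.
Qed.

Lemma nsq_mulmx_le m (A : 'M[R]_m) x : nsq (A *m x) <= opnorm A ^+ 2 * nsq x.
Proof.
have [/eqP->|x0] := boolP (x == 0).
  by rewrite mulmx0 /nsq !dotp0r mulr0.
have nx : 0 < nsq x by rewrite lt_neqAle nsq_ge0 eq_sym nsq_eq0 x0.
have sx : 0 < Num.sqrt (nsq x) by rewrite sqrtr_gt0.
have [_ ub] := opnorm_has_sup A.
have : l2norm (A *m ((Num.sqrt (nsq x))^-1 *: x)) <= opnorm A.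
  apply: (ub_le_sup ub); exists ((Num.sqrt (nsq x))^-1 *: x) => //=.
  rewrite l2normE nsqZ exprVn sqr_sqrtr ?nsq_ge0// mulVf ?gt_eqF// sqrtr1//.
rewrite -(ler_pXn2r (_ : (0 < 2)%N)) ?nnegrE ?opnorm_ge0 ?sqrtr_ge0//.
rewrite l2normE sqr_sqrtr ?nsq_ge0// -scalemxAr nsqZ exprVn.
by rewrite sqr_sqrtr ?nsq_ge0// ler_pdivrMl// mulrC.
Qed.

Lemma opnorm_le m (A : 'M[R]_m) c : 0 <= c ->
  (forall x, nsq (A *m x) <= c ^+ 2 * nsq x) -> opnorm A <= c.
Proof.
move=> c0 h; apply: ge_sup => [|_ [x /= x1 <-]].
  by have [] := opnorm_has_sup A.
rewrite -[c]ger0_norm// -sqrtr_sqr l2normE ler_sqrt ?sqr_ge0//.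
apply: le_trans (h x) _; apply: ler_piMr; first exact: sqr_ge0.
by move: x1; rewrite l2normE -[1 in X in X -> _]sqrtr1 ler_sqrt.
Qed.

Lemma nsq_mulmx_le_bilinear m n (A : 'M[R]_(m, n)) K : 0 <= K ->
  (forall x y, dotp y (A *m x) <= K * (nsq y + nsq x)) ->
  forall x, nsq (A *m x) <= (2 * K) ^+ 2 * nsq x.
Proof.
move=> K0 h x; have [K_gt0|] := ltP 0 K; last first.
  move=> Kle; have K_eq0 : K = 0 by apply/le_anti/andP.
  have := h x (A *m x); rewrite K_eq0.
  by rewrite mulr0 expr0n /= !mul0r.
(* For this multiple of [A x], the hypothesis multiplied by [4 K] reads
   [2 |A x|^2 <= |A x|^2 + 4 K^2 |x|^2]. *)
have := h x ((2 * K)^-1 *: (A *m x)).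
rewrite dotpZl nsqZ -/(nsq _) -(ler_pM2l (_ : 0 < 4 * K)); last by lra.
have -> : 4 * K * ((2 * K)^-1 * nsq (A *m x)) = 2 * nsq (A *m x).
  by field; rewrite gt_eqF.
have -> : 4 * K * (K * ((2 * K)^-1 ^+ 2 * nsq (A *m x) + nsq x)) =
    nsq (A *m x) + 4 * K ^+ 2 * nsq x.
  by field; rewrite gt_eqF.
lra.
Qed.

Lemma opnorm_le_bilinear m (A : 'M[R]_m) K : 0 <= K ->
  (forall x y, dotp y (A *m x) <= K * (nsq y + nsq x)) -> opnorm A <= 2 * K.
Proof.
by move=> K0 h; apply: opnorm_le; [lra | exact: nsq_mulmx_le_bilinear].
Qed.

Lemma dotp_mulmx_le m (A : 'M[R]_m) x y :
  2 * dotp y (A *m x) <= opnorm A * (nsq y + nsq x).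
Proof.
have [A0|] := ltP 0 (opnorm A).
  apply: le_trans (dotp_leM _ _ A0) _.
  rewrite mulrDr lerD2l ler_pdivrMl//.
  by rewrite mulrA -expr2 nsq_mulmx_le.
move=> Ale; have A0 : opnorm A = 0 by apply/le_anti/andP; rewrite opnorm_ge0.
have := nsq_mulmx_le A x; rewrite A0 expr0n /= mul0r => Ax.
have /eqP -> : A *m x == 0 by rewrite -nsq_eq0 eq_le Ax nsq_ge0.
by rewrite dotp0r mulr0 mul0r.
Qed.

End operator_norm.
Section positive_definite.
Context (R : realType).

Lemma posdefP m (A : 'M[R]_m) :
  posdef A <-> A^T = A /\ forall x : 'cV[R]_m, x != 0 -> 0 < dotp x (A *m x).
Proof. by split=> -[sA h]; split=> // x /h; rewrite dotpE mulmxA. Qed.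

Lemma posdef_sym m (A : 'M[R]_m) : posdef A -> A^T = A.
Proof. by case. Qed.

Lemma posdef_gt0 m (A : 'M[R]_m) x : posdef A -> x != 0 -> 0 < dotp x (A *m x).
Proof. by case/posdefP => _; apply. Qed.

Lemma posdef_ge0 m (A : 'M[R]_m) x : posdef A -> 0 <= dotp x (A *m x).
Proof.
move=> pA; have [/eqP->|x0] := boolP (x == 0); last exact/ltW/posdef_gt0.
by rewrite mulmx0 dotp0r.
Qed.

Lemma posdef_unitmx m (A : 'M[R]_m) : posdef A -> A \in unitmx.
Proof.
move=> pA; rewrite -row_free_unit -kermx_eq0; apply/eqP/row_matrixP => i.
apply/eqP/negPn/negP => k0.
have Ak : A *m (row i (kermx A))^T = 0.
  by rewrite -[A in A *m _](posdef_sym pA) -trmx_mul -row_mul mulmx_ker row0 trmx0.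
have := posdef_gt0 (x := (row i (kermx A))^T) pA.
rewrite Ak dotp0r ltxx => h; suff : false by []; apply: h.
by apply: contra k0 => /eqP e; rewrite -[row i (kermx A)]trmxK e trmx0 row0.
Qed.

Lemma invmx_sym m (A : 'M[R]_m) : A^T = A -> (invmx A)^T = invmx A.
Proof. by move=> sA; rewrite trmx_inv sA. Qed.

(* Polarization turns a bound on a quadratic form into one on its bilinear
   form. *)
Lemma dotp_sym_le m (A M : 'M[R]_m) e x y : M^T = M ->
  (forall v, `|dotp v (M *m v)| <= e * dotp v (A *m v)) ->
  2 * `|dotp x (M *m y)| <= e * (dotp x (A *m x) + dotp y (A *m y)).
Proof.
move=> sM h.
have MC : dotp y (M *m x) = dotp x (M *m y) by rewrite dotpC dotp_mulmx sM.
have := h (x + y); have := h (x - y).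
rewrite !mulmxBr !mulmxDr !dotpBl !dotpDl !dotpBr !dotpDr MC.
rewrite !ler_norml => /andP[h1 h2] /andP[h3 h4].
suff : `|2 * dotp x (M *m y)| <= e * (dotp x (A *m x) + dotp y (A *m y)).
  by rewrite normrM ger0_norm.
rewrite ler_norml; apply/andP; split; lra.
Qed.

Section coercive_inverse.
Context (m : nat) (A : 'M[R]_m) (c : R).
Hypotheses (pA : posdef A) (cA : forall u, nsq u <= c * dotp u (A *m u)).

Lemma dotp_invmx v :
  dotp v (invmx A *m v) = dotp (invmx A *m v) (A *m (invmx A *m v)).
Proof. by rewrite mulKVmx ?posdef_unitmx// dotpC. Qed.

Lemma dotp_invmx_le v : 0 < c -> dotp v (invmx A *m v) <= c * nsq v.
Proof.
move=> c0; have := cA (invmx A *m v); rewrite -dotp_invmx => h.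
have := dotp_leM v (invmx A *m v) c0; rewrite -(ler_pM2l c0) => h2.
have e : c * (c * nsq v + c^-1 * nsq (invmx A *m v)) =
  c * (c * nsq v) + nsq (invmx A *m v).
  by field; rewrite gt_eqF.
rewrite e in h2; rewrite -(ler_pM2l c0); lra.
Qed.

Lemma nsq_invmx_le v : 0 < c -> nsq (invmx A *m v) <= c ^+ 2 * nsq v.
Proof.
move=> c0; apply: le_trans (cA _) _; rewrite -dotp_invmx expr2 -mulrA.
by rewrite ler_pM2l// dotp_invmx_le.
Qed.

End coercive_inverse.

(** In [B^-1 - A^-1 = - B^-1 (B - A) A^-1], polarization compares the middle factor with the form of
    [A] at [B^-1 y] and [A^-1 x]. There that form is at most [4 c |y|^2] and [c |x|^2], so the bound
    is linear in [c] and free of the norm of [A]. *)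
Lemma invmx_perturbation m (A B : 'M[R]_m) (c e : R) :
  posdef A -> B^T = B -> 0 < c -> (forall u, nsq u <= c * dotp u (A *m u)) ->
  e <= 2^-1 ->
  (forall u, `|dotp u ((B - A) *m u)| <= e * dotp u (A *m u)) ->
  B \in unitmx /\ forall x y,
    dotp y ((invmx B - invmx A) *m x) <= 2 * e * c * (nsq y + nsq x).
Proof.
move=> pA sB c0 cA e2 h.
have hB u : dotp u (A *m u) <= 2 * dotp u (B *m u).
  have := h u; rewrite mulmxBl dotpBr ler_norml => /andP[h1 _].
  have := posdef_ge0 u pA => h0.
  have : e * dotp u (A *m u) <= 2^-1 * dotp u (A *m u) by rewrite ler_wpM2r.
  lra.
have pB : posdef B.
  by apply/posdefP; split=> // u /(posdef_gt0 pA); have := hB u; lra.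
have uA := posdef_unitmx pA; have uB := posdef_unitmx pB.
split=> // x y.
have cB u : nsq u <= (2 * c) * dotp u (B *m u).
  apply: le_trans (cA u) _; rewrite -mulrA mulrCA ler_pM2l//; exact: hB.
have -> : invmx B - invmx A = - (invmx B *m (B - A) *m invmx A).
  by rewrite mulmxBr mulVmx// mulmxBl mul1mx -mulmxA mulmxV// mulmx1 opprB.
rewrite mulNmx dotpNr -!mulmxA -[X in dotp _ (X *m _)]trmxK -dotp_mulmx.
rewrite (invmx_sym sB).
have sBA : (B - A)^T = B - A by rewrite linearB /= sB (posdef_sym pA).
have := dotp_sym_le (invmx B *m y) (invmx A *m x) sBA h.
set D := dotp _ _; have := hB (invmx B *m y).
rewrite -(dotp_invmx pB) -(dotp_invmx pA) => h1 h2.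
have c20 : 0 < 2 * c by lra.
have h3 := dotp_invmx_le pB cB y c20; have h4 := dotp_invmx_le pA cA x c0.
have := ler_norm (- D); rewrite normrN => h5.
(* If [e < 0], the hypothesis leaves no nonzero vector. *)
have e0 : 0 <= e \/ nsq x = 0 /\ nsq y = 0.
  have [//|] := leP 0 e; [by left | move=> eneg; right].
  have z (u : 'cV[R]_m) : nsq u = 0.
    apply/eqP; rewrite nsq_eq0; apply/negPn/negP => /(posdef_gt0 pA) u0.
    have := le_trans (normr_ge0 _) (h u); rewrite leNgt.
    by rewrite nmulr_rlt0// u0.
  by rewrite !z.
case: e0 => [e0|[x0 y0]]; last first.
  have n0 (u : 'cV[R]_m) : nsq u = 0 -> u = 0.
    by move=> /eqP; rewrite nsq_eq0 => /eqP.
  by rewrite x0 y0 /D (n0 _ x0) !mulmx0 dotp0r oppr0 addr0 mulr0.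
have : e * (dotp (invmx B *m y) (A *m (invmx B *m y)) +
            dotp x (invmx A *m x)) <= e * (4 * c * nsq y + c * nsq x).
  by rewrite ler_wpM2l//; lra.
have := nsq_ge0 x; have := nsq_ge0 y => y0 x0.
have : 0 <= e * (c * nsq x) by rewrite !mulr_ge0// ltW.
lra.
Qed.

Lemma posdef_opnorm_gt0 m (A : 'M[R]_m) : (0 < m)%N -> posdef A -> 0 < opnorm A.
Proof.
move=> m0 pA; rewrite lt_neqAle opnorm_ge0 andbT eq_sym; apply/eqP => A0.
pose x : 'cV[R]_m := const_mx 1.
have x0 : x != 0.
  by apply/eqP => /colP/(_ (Ordinal m0)); rewrite !mxE => /eqP; rewrite oner_eq0.
have := dotp_mulmx_le A x x; rewrite A0 mul0r.
by have := posdef_gt0 pA x0; lra.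
Qed.

Lemma posdef_nsq_le m (A : 'M[R]_m) v : posdef A ->
  nsq (A *m v) <= opnorm A * dotp v (A *m v).
Proof.
move=> pA.
have [/eqP A0|A0] := boolP (opnorm A == 0).
  by have := nsq_mulmx_le A v; rewrite A0 expr0n /= !mul0r.
have {}A0 : 0 < opnorm A by rewrite lt_neqAle opnorm_ge0 eq_sym A0.
have := posdef_ge0 (v - (opnorm A)^-1 *: (A *m v)) pA.
rewrite mulmxBr -scalemxAr dotpBl !dotpBr !dotpZl !dotpZr -/(nsq (A *m v)).
have -> : dotp v (A *m (A *m v)) = nsq (A *m v).
  by rewrite /nsq dotp_mulmx (posdef_sym pA).
have := dotp_mulmx_le A (A *m v) (A *m v).
set N := nsq (A *m v); set Q := dotp (A *m v) _; set q := dotp v _ => hQ h.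
have {hQ} : (opnorm A)^-1 * ((opnorm A)^-1 * Q) <= (opnorm A)^-1 * N.
  by rewrite ler_pM2l ?invr_gt0// ler_pdivrMl//; lra.
have -> : (N <= opnorm A * q) = ((opnorm A)^-1 * N <= q) by rewrite ler_pdivrMl.
lra.
Qed.

Lemma posdef_invmx_coercive m (A : 'M[R]_m) x : posdef A ->
  nsq x <= opnorm A * dotp x (invmx A *m x).
Proof.
move=> pA; have := posdef_nsq_le (invmx A *m x) pA.
by rewrite mulKVmx ?posdef_unitmx// dotpC.
Qed.

Lemma condition_number_ge1 m (A : 'M[R]_m) : (0 < m)%N -> posdef A ->
  1 <= condition_number A.
Proof.
move=> m0 pA; pose x : 'cV[R]_m := const_mx 1.
have x0 : x != 0.
  by apply/eqP => /colP/(_ (Ordinal m0)); rewrite !mxE => /eqP; rewrite oner_eq0.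
have nx : 0 < nsq x by rewrite lt_neqAle nsq_ge0 eq_sym nsq_eq0 x0.
have := nsq_mulmx_le A (invmx A *m x); rewrite mulKVmx ?posdef_unitmx//.
move=> h; have {h} : nsq x <= opnorm A ^+ 2 * (opnorm (invmx A) ^+ 2 * nsq x).
  by apply: le_trans h _; rewrite ler_wpM2l ?sqr_ge0// nsq_mulmx_le.
rewrite mulrA -exprMn -[leLHS]mul1r ler_pM2r// -/(condition_number A).
by rewrite expr_ge1// mulr_ge0 ?opnorm_ge0.
Qed.

End positive_definite.
(** * Quadratic forms controlled on a finite net *)

Section whitening.
Context (R : realType).

Lemma posdef_congr m n (A : 'M[R]_m) (L : 'M[R]_(m, n)) :
  posdef A -> (forall x : 'cV_n, x != 0 -> L *m x != 0) ->
  posdef (L^T *m A *m L).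
Proof.
move=> pA Linj; apply/posdefP; split=> [|x x0].
  by rewrite !trmx_mul trmxK (posdef_sym pA) mulmxA.
by rewrite -!mulmxA -[L in dotp _ (L^T *m _)]trmxK trmxK -dotp_mulmx posdef_gt0 ?Linj.
Qed.

(* Symmetric Gaussian elimination of the first coordinate. *)
Lemma posdef_whitening m (A : 'M[R]_m) : posdef A ->
  exists2 D : 'M[R]_m, D \in unitmx & D^T *m A *m D = 1%:M.
Proof.
elim: m A => [|m IH] A pA.
  exists 1%:M; first exact: unitmx1.
  by apply/matrixP => -[].
move: A pA; rewrite -[m.+1]/(1 + m)%N => A pA.
pose a := A 0 0.
pose b := dlsubmx A.
pose L : 'M[R]_(1 + m) := block_mx 1%:M (- a^-1 *: b^T) 0 1%:M.
have a0 : 0 < a.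
  have e0 : (delta_mx 0 0 : 'cV[R]_(1 + m)) != 0.
    by apply/eqP => /colP/(_ 0); rewrite !mxE => /eqP; rewrite oner_eq0.
  have := posdef_gt0 pA e0; rewrite /dotp (bigD1 0)//= big1 ?addr0.
    by rewrite -colE !mxE mul1r.
  by move=> i i0; rewrite mxE (negbTE i0) mul0r.
have eA : A = block_mx a%:M b^T b (drsubmx A).
  rewrite -[LHS]submxK; congr block_mx.
    by apply/matrixP => i j; rewrite !ord1 !mxE eqxx mulr1n; congr (A _ _); exact/val_inj.
  by rewrite /b trmx_dlsub (posdef_sym pA).
have LAL : L^T *m A *m L = block_mx a%:M 0 0 (drsubmx A - a^-1 *: (b *m b^T)).
  rewrite {1}eA /L tr_block_mx !trmx1 trmx0 linearZ /= trmxK.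
  rewrite !mulmx_block !mul1mx !mul0mx !mulmx1 !mulmx0 !addr0 ?add0r.
  rewrite -!scalemxAl -!scalemxAr !mul_mx_scalar !mul_scalar_mx !scalerA.
  rewrite !mulNr mulVf ?gt_eqF// !scaleN1r !addNr mul0mx scaler0 add0r.
  by rewrite scaleNr addrC.
have L_inj n (x : 'M[R]_(1 + m, n)) : L *m x = 0 -> x = 0.
  rewrite /L -[x]vsubmxK mul_block_col !mul1mx mul0mx add0r.
  move=> /eqP; rewrite -col_mx0 => /eqP/eq_col_mx [h1 h2].
  by move: h1; rewrite h2 mulmx0 addr0 => ->; rewrite col_mx0.
(* This Schur complement is the congruence of [A] by [L *m J], where [J] includes the last [m]
   coordinates. *)
have pS : posdef (drsubmx A - a^-1 *: (b *m b^T)).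
  pose J : 'M[R]_(1 + m, m) := col_mx 0 1%:M.
  have -> : drsubmx A - a^-1 *: (b *m b^T) = (L *m J)^T *m A *m (L *m J).
    rewrite trmx_mul -!mulmxA (mulmxA _ A) (mulmxA _ L) LAL /J tr_col_mx.
    by rewrite mul_block_col mul_row_col trmx0 trmx1 !(mul0mx, mulmx0, mul1mx, mulmx1, add0r).
  apply: posdef_congr => // x; apply: contra => /eqP.
  rewrite -mulmxA => /L_inj; rewrite /J mul_col_mx mul1mx mul0mx => /eqP.
  by rewrite -col_mx0 => /eqP/eq_col_mx[_ ->].
have [D uD DSD] := IH _ pS.
pose G : 'M[R]_(1 + m) := block_mx ((Num.sqrt a)^-1)%:M 0 0 D.
have e : (L *m G)^T *m A *m (L *m G) = 1%:M.
  rewrite trmx_mul -!mulmxA (mulmxA _ A) (mulmxA _ L) LAL /G tr_block_mx.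
  rewrite !trmx0 !mulmx_block !mulmx0 !mul0mx !addr0 !add0r.
  rewrite !mulmx0 tr_scalar_mx -!scalar_mxM mulmxA DSD.
  rewrite mulrCA -invfM -expr2 sqr_sqrtr ?(ltW a0)// mulfV ?gt_eqF//.
  by rewrite -scalar_mx_block.
exists (L *m G) => //.
by have /mulmx1_unit[] := e.
Qed.

End whitening.
Section grid_net.
Context (R : realType) (m : nat).

(* Integer vectors, a coordinate being encoded by its sign and its modulus (so
   that 0 occurs twice); grid_point scales them by 1 / (4 sqrt m). *)
Definition grid : finType := {ffun 'I_m -> bool * 'I_(4 * m).+1}.

Definition grid_point (f : grid) : 'cV[R]_m :=
  \col_i ((-1) ^+ (f i).1 * ((f i).2 : nat)%:R / (4 * Num.sqrt m%:R)).

Definition grid_net : {set grid} := [set f | nsq (grid_point f) <= 1]%SET.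

Lemma grid_point_sqr (f : grid) i :
  grid_point f i 0 ^+ 2 = ((f i).2 : nat)%:R ^+ 2 / (16 * m%:R).
Proof.
rewrite mxE exprMn exprVn exprMn sqrr_sign mul1r exprMn sqr_sqrtr//.
by congr (_ / (_ * _)); ring.
Qed.

(** Rounding each modulus down costs at most [1 / (4 sqrt m)] per coordinate, so 1/16 in squared
    norm; as moduli only decrease, the point stays in the unit ball. *)
Lemma grid_net_approx (x : 'cV[R]_m) : nsq x <= 1 ->
  exists2 f, f \in grid_net & nsq (x - grid_point f) <= 16^-1.
Proof.
move=> x1; pose s : R := 4 * Num.sqrt m%:R.
have s0 : 0 <= s by rewrite mulr_ge0 ?sqrtr_ge0.
pose q i := Num.truncn (s * `|x i 0|).
have m_gt0 (i : 'I_m) : (0 < m)%N by exact: leq_ltn_trans (leq0n i) (ltn_ord i).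
have s_gt0 (i : 'I_m) : 0 < s by rewrite mulr_gt0// sqrtr_gt0 ltr0n (m_gt0 i).
have xi i : `|x i 0| <= 1.
  rewrite -(@ler_pXn2r _ 2) ?nnegrE// expr1n real_normK ?num_real//.
  apply: le_trans x1; rewrite nsqE (bigD1 i)//= lerDl.
  by apply: sumr_ge0 => j _; exact: sqr_ge0.
have q_le i : (q i)%:R <= s * `|x i 0| by rewrite truncn_le// mulr_ge0.
have q_gt i : s * `|x i 0| < (q i).+1%:R by rewrite truncnS_gt.
have qM i : (q i < (4 * m).+1)%N.
  rewrite ltnS -(ler_nat R); apply: le_trans (q_le i) _.
  apply: (@le_trans _ _ s); first by rewrite ler_piMr.
  rewrite natrM ler_wpM2l// -[leRHS]ger0_norm// -sqrtr_sqr ler_sqrt ?sqr_ge0//.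
  by rewrite -natrX ler_nat leq_pmull// (m_gt0 i).
pose f : grid := [ffun i => (x i 0 < 0, Ordinal (qM i))].
have fE i : grid_point f i 0 = (-1) ^+ (x i 0 < 0)%R * (q i)%:R / s.
  by rewrite mxE ffunE.
have xE i : x i 0 = (-1) ^+ (x i 0 < 0)%R * `|x i 0| by rewrite -realEsign ?num_real.
exists f.
  rewrite inE; apply: le_trans x1; rewrite !nsqE; apply: ler_sum => i _.
  rewrite -(real_normK (num_real (grid_point f i 0))) -(real_normK (num_real (x i 0))).
  rewrite ler_pXn2r ?nnegrE// fE 2!normrM normr_sign mul1r normfV normr_nat (ger0_norm s0).
  by rewrite ler_pdivrMr ?(s_gt0 i)// mulrC.
rewrite nsqE; apply: (@le_trans _ _ (\sum_(i < m) (16 * m%:R)^-1)); last first.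
  rewrite sumr_const card_ord -[leLHS]mulr_natr invfM -mulrA.
  have [->|m0] := posnP m; first by rewrite mulr0 mulr0 invr_ge0.
  by rewrite mulVf ?mulr1// pnatr_eq0 -lt0n.
apply: ler_sum => i _; rewrite 2!mxE fE {1}xE -mulrA -mulrBr exprMn sqrr_sign mul1r.
have -> : (16 * m%:R)^-1 = (s^-1) ^+ 2.
  by rewrite exprVn exprMn sqr_sqrtr//; congr ((_ * _)^-1); ring.
have h0 : 0 <= `|x i 0| - (q i)%:R / s.
  by rewrite subr_ge0 ler_pdivrMr ?(s_gt0 i)// mulrC.
rewrite ler_pXn2r ?nnegrE ?invr_ge0//.
rewrite lerBlDr -[X in X + _]mul1r -mulrDl ler_pdivlMr ?(s_gt0 i)// mulrC addrC.
by have := q_gt i; rewrite -natr1 => /ltW.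
Qed.

(** On the net the integer moduli satisfy [sum k_i <= sum k_i^2 <= 16 m], so the weight
    [2^(16 m - sum k_i)] is at least 1. Over the whole grid the weights factor into [2^(16 m)] and
    [m] geometric sums, each at most 4 with the two signs. Counting the whole grid would cost a
    factor [log m] in the exponent. *)
Lemma card_grid_net : (#|grid_net| <= 2 ^ (18 * m))%N.
Proof.
rewrite -(ler_nat R) natrX -sum1_card natr_sum.
have half_ge0 k : 0 <= (2^-1 : R) ^+ k by rewrite exprn_ge0.
apply: (@le_trans _ _ (\sum_(f : grid)
    2 ^+ (16 * m) * \prod_(i < m) (2^-1 : R) ^+ (f i).2)).
  rewrite [leRHS](bigID (mem grid_net))/=; apply: ler_wpDr.
    by apply: sumr_ge0 => f _; rewrite mulr_ge0 ?exprn_ge0// prodr_ge0.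
  apply: ler_sum => f; rewrite inE nsqE => h.
  rewrite -expr_sum exprVn ler_pdivlMr ?exprn_gt0// mul1r.
  rewrite ler_eXn2l ?ltr1n//.
  have : \sum_(i < m) ((f i).2 : nat)%:R ^+ 2 <= 16 * m%:R :> R.
    have [m0|m0] := posnP m.
      by rewrite big1 ?mulr_ge0// => i _; have := ltn_ord i; rewrite [X in (_ < X)%N -> _]m0.
    have m16 : 0 < 16 * m%:R :> R by rewrite mulr_gt0// ltr0n.
    move: h; under eq_bigr do rewrite grid_point_sqr.
    by rewrite -mulr_suml ler_pdivrMr// mul1r.
  rewrite (eq_bigr (fun i : 'I_m => ((f i).2 ^ 2)%:R)) => [|i _]; last by rewrite natrX.
  rewrite -natr_sum -natrM ler_nat; apply: leq_trans.
  by apply: leq_sum => i _; case: (val _) => // k; rewrite leq_pmulr.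
rewrite -mulr_sumr -(bigA_distr_bigA (fun _ (u : bool * 'I_(4 * m).+1) =>
  (2^-1 : R) ^+ u.2)) /= prodr_const card_ord.
rewrite (_ : 18 * m = 16 * m + 2 * m)%N; last by rewrite -mulnDl.
rewrite exprD; apply: ler_wpM2l; first exact: exprn_ge0.
rewrite exprM; apply: lerXn2r; rewrite ?nnegrE ?exprn_ge0//.
  by apply: sumr_ge0.
rewrite -(pair_bigA _ (fun _ (k : 'I_(4 * m).+1) => (2^-1 : R) ^+ k)) /=.
have e : \sum_(k < (4 * m).+1) (2^-1 : R) ^+ k = 2 * (1 - 2^-1 ^+ (4 * m).+1).
  have := subrXX (1 : R) 2^-1 (4 * m).+1; rewrite expr1n => ->.
  rewrite mulrA (_ : 2 * (1 - 2^-1) = 1) ?mul1r; last by field.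
  by apply: eq_bigr => k _; rewrite expr1n mul1r.
by rewrite big_bool /= e; have := half_ge0 (4 * m).+1; lra.
Qed.

(** With [s = ||M||], the identity [x.Mx = y.My + (x - y).M(x + y)] bounds the form on the unit ball
    by [e + 5/8 s]. By polarization [s] obeys the same bound, so [s <= 8/3 e], and the form is at
    most [8/3 e]. *)
Lemma net_quadratic_le (M : 'M[R]_m) e : M^T = M -> 0 <= e ->
  (forall f, f \in grid_net ->
    `|dotp (grid_point f) (M *m grid_point f)| <= e * nsq (grid_point f)) ->
  forall x, `|dotp x (M *m x)| <= 3 * e * nsq x.
Proof.
move=> sM e0 h; set s := opnorm M.
have s0 : 0 <= s := opnorm_ge0 M.
have absM u v : 2 * `|dotp u (M *m v)| <= s * (nsq u + nsq v).
  rewrite -(ger0_norm (ler0n R 2)) -normrM ler_norml; apply/andP; split.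
    have := dotp_mulmx_le M v (- u); rewrite dotpNl nsqN -/s; lra.
  exact: dotp_mulmx_le.
have ball x : nsq x <= 1 -> `|dotp x (M *m x)| <= e + 5 / 8 * s.
  move=> x1; have [f /[dup] fnet] := grid_net_approx x1.
  rewrite inE; set y := grid_point f => y1 xy.
  have hy : `|dotp y (M *m y)| <= e.
    by apply: le_trans (h f fnet) _; rewrite -/y ler_piMr.
  have split_xy : dotp x (M *m x) = dotp y (M *m y) + dotp (x - y) (M *m (x + y)).
    have MC : dotp y (M *m x) = dotp x (M *m y) by rewrite dotpC dotp_mulmx sM.
    by rewrite mulmxDr dotpBl !dotpDr MC; ring.
  rewrite split_xy; apply: le_trans (ler_normD _ _) _; apply: lerD => //.
  (* The scalings balance [|x - y| <= 1/4] against [|x + y| <= 2]: the squares sum to at most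
     [1 + 1/4]. *)
  have := absM (4 *: (x - y)) (4^-1 *: (x + y)).
  rewrite -scalemxAr dotpZl dotpZr mulrA mulfV// mul1r !nsqZ => hs.
  have xy4 : nsq (x + y) <= 4 by rewrite nsqD; have := dotp_le x y; lra.
  have : s * (4 ^+ 2 * nsq (x - y) + 4^-1 ^+ 2 * nsq (x + y)) <= s * (5 / 4).
    by rewrite ler_wpM2l//; lra.
  lra.
have all x : `|dotp x (M *m x)| <= (e + 5 / 8 * s) * nsq x.
  have [/eqP->|x0] := boolP (x == 0).
    by rewrite mulmx0 dotp0r normr0 /nsq dotp0r mulr0.
  have nx : 0 < nsq x by rewrite lt_neqAle nsq_ge0 eq_sym nsq_eq0 x0.
  have qx : (Num.sqrt (nsq x))^-1 ^+ 2 = (nsq x)^-1.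
    by rewrite exprVn sqr_sqrtr ?nsq_ge0.
  have := ball ((Num.sqrt (nsq x))^-1 *: x).
  rewrite -scalemxAr dotpZl dotpZr mulrA -expr2 nsqZ qx mulVf ?gt_eqF//.
  move=> /(_ (lexx _)); rewrite normrM gtr0_norm ?invr_gt0//.
  by rewrite ler_pdivrMl// mulrC.
have s_le : s <= 2 * ((e + 5 / 8 * s) / 2).
  apply: opnorm_le_bilinear => [|x y]; first by rewrite divr_ge0//; lra.
  have := @dotp_sym_le _ _ 1%:M M (e + 5 / 8 * s) y x sM.
  rewrite !mul1mx -/(nsq x) -/(nsq y) => /(_ _)/le_trans hyp.
  have : 2 * `|dotp y (M *m x)| <= (e + 5 / 8 * s) * (nsq y + nsq x).
    by apply: hyp => // v; rewrite mul1mx; exact: all.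
  by have := ler_norm (dotp y (M *m x)); lra.
move=> x; apply: le_trans (all x) _; rewrite ler_wpM2r ?nsq_ge0//; lra.
Qed.

End grid_net.
(** * Bias and variance of one local inverse *)

Section restriction.
Context (R : realType) (n w : nat) (F : 'M[R]_(w, n)).
Hypothesis FFT : F *m F^T = 1%:M.

Lemma nsq_restrict_le x : nsq (F *m x) <= nsq x.
Proof.
have := nsq_ge0 (x - F^T *m (F *m x)); rewrite nsqB dotpC dotp_mulmx trmxK.
have -> : nsq (F^T *m (F *m x)) = nsq (F *m x).
  by rewrite /nsq dotp_mulmx trmxK (mulmxA F) FFT mul1mx.
by rewrite -/(nsq (F *m x)); lra.
Qed.

Lemma nsq_extend v : nsq (F^T *m v) = nsq v.
Proof. by rewrite /nsq dotp_mulmx trmxK mulmxA FFT mul1mx. Qed.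

Context (Omega : 'M[R]_n).
Hypotheses (pOmega : posdef Omega) (n0 : (0 < n)%N).
Let Sigma := invmx Omega.
Let A := F *m Sigma *m F^T.

(** Extension by zero is an isometry, so every window inherits the coercivity of [Sigma] with the
    same constant. *)
Lemma local_cov_coercive u : nsq u <= opnorm Omega * dotp u (A *m u).
Proof.
rewrite -(nsq_extend u); apply: le_trans (posdef_invmx_coercive _ pOmega) _.
by rewrite dotp_mulmx trmxK -!mulmxA.
Qed.

Lemma local_cov_posdef : posdef A.
Proof.
have om0 := posdef_opnorm_gt0 n0 pOmega.
apply/posdefP; split=> [|u u0].
  by rewrite !trmx_mul trmxK (invmx_sym (posdef_sym pOmega)) mulmxA.
have := local_cov_coercive u; have : 0 < nsq u.
  by rewrite lt_neqAle nsq_ge0 eq_sym nsq_eq0 u0.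
by move=> h /(lt_le_trans h); rewrite pmulr_rgt0.
Qed.

(* With G the extension by zero of A^-1, G Sigma is the identity on vectors
   supported in the window, so that the bias only sees the entries of Omega
   that leave the window. *)
Lemma local_bias (c : R) x y : 0 < c ->
  F^T *m (F *m x) = x -> F^T *m (F *m y) = y ->
  2 * dotp y ((F^T *m invmx A *m F - Omega) *m x) <=
  c * (condition_number Omega ^+ 2 * nsq y) +
  c^-1 * nsq (Omega *m x - F^T *m (F *m (Omega *m x))).
Proof.
move=> c0 Fx Fy; set z := Omega *m x - _; set G := F^T *m invmx A *m F.
have uO := posdef_unitmx pOmega; have uA := posdef_unitmx local_cov_posdef.
have om0 := posdef_opnorm_gt0 n0 pOmega.
have sS : Sigma^T = Sigma := invmx_sym (posdef_sym pOmega).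
have sG : G^T = G.
  by rewrite !trmx_mul trmxK (invmx_sym (posdef_sym local_cov_posdef)) mulmxA.
have GSF : G *m Sigma *m F^T = F^T.
  by rewrite /G -!mulmxA (mulmxA F) -/A mulVmx// mulmx1.
have GSFv (v : 'cV_w) : G *m Sigma *m (F^T *m v) = F^T *m v.
  by rewrite mulmxA GSF.
have Gx : G *m x = F^T *m (F *m (Omega *m x)) + G *m Sigma *m z.
  by rewrite /z mulmxBr GSFv addrC subrK -(mulmxA G) /Sigma mulKmx.
(* Tested against [y], which lives in the window, the first term of [Gx] cancels with [Omega x]. *)
have prF v : dotp y (F^T *m (F *m v)) = dotp y v.
  by rewrite -[in RHS]Fy dotp_mulmx trmxK dotp_mulmx.
(* By symmetry [G Sigma] moves to the side of [y], where it costs [||Sigma|| ||Omega||], the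
   condition number. *)
have -> : dotp y ((G - Omega) *m x) = dotp (Sigma *m (G *m y)) z.
  rewrite mulmxBl dotpBr Gx dotpDr prF addrAC subrr add0r.
  by rewrite dotp_mulmx sS dotp_mulmx sG mulmxA.
apply: le_trans (dotp_leM _ _ c0) _; rewrite lerD2r ler_pM2l//.
apply: le_trans (nsq_mulmx_le _ _) _.
have -> : condition_number Omega ^+ 2 * nsq y =
    opnorm Sigma ^+ 2 * (opnorm Omega ^+ 2 * nsq y).
  by rewrite /condition_number -/Sigma; ring.
apply: ler_wpM2l; first exact: sqr_ge0.
rewrite /G -!mulmxA nsq_extend.
apply: le_trans (nsq_invmx_le local_cov_posdef local_cov_coercive _ om0) _.
by rewrite ler_wpM2l ?sqr_ge0// nsq_restrict_le.
Qed.

Lemma local_variance (B : 'M[R]_w) e x y : B^T = B -> 0 <= e -> e <= 2^-1 ->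
  (forall u, `|dotp u ((B - A) *m u)| <= e * dotp u (A *m u)) ->
  B \in unitmx /\
  dotp y ((F^T *m invmx B *m F - F^T *m invmx A *m F) *m x) <=
    2 * e * opnorm Omega * (nsq y + nsq x).
Proof.
move=> sB e0 e2 h; have om0 := posdef_opnorm_gt0 n0 pOmega.
have [uB hB] := invmx_perturbation local_cov_posdef sB om0 local_cov_coercive e2 h.
split=> //; rewrite -mulmxBl -mulmxBr -!mulmxA -dotp_mulmx.
apply: le_trans (hB _ _) _; rewrite ler_wpM2l ?mulr_ge0 ?opnorm_ge0//.
by apply: lerD; exact: nsq_restrict_le.
Qed.

End restriction.
(** * Assembling the blocks *)

Section selection.
Context (R : realType) (I : finType) (W : {set I}).

(** Restriction to [W] as a matrix: its transpose is the extension by zero, and passing to a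
    submatrix becomes a product. *)
Definition sel : 'M[R]_(#|W|, #|{: I}|) :=
  \matrix_(a, c) (enum_rank (enum_val a) == c)%:R.

Lemma sel_mul m (X : 'M[R]_(#|{: I}|, m)) a k :
  (sel *m X) a k = X (enum_rank (enum_val a)) k.
Proof.
rewrite mxE (bigD1 (enum_rank (enum_val a)))//= big1 => [|c /negbTE ca].
  by rewrite mxE eqxx mul1r addr0.
by rewrite mxE eq_sym ca mul0r.
Qed.

Lemma mul_sel_tr m (X : 'M[R]_(m, #|{: I}|)) k a :
  (X *m sel^T) k a = X k (enum_rank (enum_val a)).
Proof. by rewrite -[X *m _]trmxK mxE trmx_mul trmxK sel_mul mxE. Qed.

Lemma sel_sel_tr : sel *m sel^T = 1%:M.
Proof.
apply/matrixP => a c; rewrite sel_mul !mxE; congr (_ : bool)%:R.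
by rewrite (inj_eq enum_rank_inj) (inj_eq enum_val_inj) eq_sym.
Qed.

Lemma sel_tr_sel (v : 'cV[R]_#|{: I}|) c :
  (sel^T *m (sel *m v)) c 0 = if enum_val c \in W then v c 0 else 0.
Proof.
rewrite mxE; under eq_bigr do rewrite sel_mul !mxE.
rewrite -(big_enum_val (A := mem W) (fun t => (enum_rank t == c)%:R * v (enum_rank t) 0)).
case: ifPn => cW.
  rewrite (bigD1 (enum_val c))//= enum_valK eqxx mul1r big1 ?addr0// => t /andP[_ tc].
  rewrite (_ : _ == c = false) ?mul0r//; apply: contraNF tc => /eqP <-.
  by rewrite enum_rankK.
rewrite big1// => t tW; rewrite (_ : _ == c = false) ?mul0r//.
by apply: contraNF cW => /eqP <-; rewrite enum_rankK.
Qed.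

Lemma sel_support (v : 'cV[R]_#|{: I}|) :
  (forall c, enum_val c \notin W -> v c 0 = 0) -> sel^T *m (sel *m v) = v.
Proof.
by move=> h; apply/colP => c; rewrite sel_tr_sel; case: ifPn => // /h ->.
Qed.

Lemma sub_entryE (M : 'M[R]_#|W|) i k :
  sub_entry M (enum_val i) (enum_val k) = (sel^T *m M *m sel) i k.
Proof.
rewrite /sub_entry -mulmxA mxE big_mkcond; apply: eq_bigr => a _.
rewrite 2!mxE (_ : (enum_rank _ == i) = (enum_val a == enum_val i)); last first.
  by rewrite -(inj_eq enum_val_inj) enum_rankK.
case: eqP => _; last by rewrite mul0r.
rewrite mul1r mxE big_mkcond; apply: eq_bigr => c _.
rewrite mxE (_ : (enum_rank _ == k) = (enum_val c == enum_val k)); last first.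
  by rewrite -(inj_eq enum_val_inj) enum_rankK.
by case: eqP => _; rewrite ?mulr1 ?mulr0.
Qed.

End selection.

Section masks.
Context (R : realType) (I : finType).
Implicit Types (A : operator R I) (x y : 'cV[R]_#|{: I}|) (D : pred I).

Definition mask (m : rel I) A : operator R I :=
  \matrix_(i, k) if m (enum_val i) (enum_val k) then A i k else 0.

Definition proj D x : 'cV[R]_#|{: I}| :=
  \col_i if D (enum_val i) then x i 0 else 0.

Lemma dotp_mulmxE n (A : 'M[R]_n) (x y : 'cV[R]_n) :
  dotp y (A *m x) = \sum_i \sum_k y i 0 * A i k * x k 0.
Proof.
by apply: eq_bigr => i _; rewrite mxE mulr_sumr; apply: eq_bigr => k _; rewrite mulrA.
Qed.

Lemma dotp_mask D D' A x y :
  dotp y (mask (fun t t' => D t && D' t') A *m x) =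
  dotp (proj D y) (A *m proj D' x).
Proof.
rewrite !dotp_mulmxE; apply: eq_bigr => i _; apply: eq_bigr => k _; rewrite !mxE.
by case: (D _); case: (D' _); rewrite ?(mul0r, mulr0).
Qed.

Lemma nsq_proj D x : nsq (proj D x) = \sum_i (D (enum_val i))%:R * x i 0 ^+ 2.
Proof.
rewrite nsqE; apply: eq_bigr => i _; rewrite mxE.
by case: (D _); rewrite ?mul1r ?mul0r ?expr0n.
Qed.

(** Each entry [|M i k|] is charged half to [y_i^2], through its row, and half to [x_k^2], through
    its column. *)
Lemma schur_test n (M : 'M[R]_n) (c : R) :
  (forall i, \sum_k `|M i k| <= c) -> (forall k, \sum_i `|M i k| <= c) ->
  forall x y : 'cV[R]_n, dotp y (M *m x) <= c / 2 * (nsq y + nsq x).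
Proof.
move=> hr hc x y; rewrite dotp_mulmxE.
apply: (@le_trans _ _ (\sum_i \sum_k
    (2^-1 * (`|M i k| * y i 0 ^+ 2) + 2^-1 * (`|M i k| * x k 0 ^+ 2)))).
  apply: ler_sum => i _; apply: ler_sum => k _.
  have := ler_norm (y i 0 * M i k * x k 0); rewrite !normrM.
  rewrite -(real_normK (num_real (y i 0))) -(real_normK (num_real (x k 0))).
  have : 0 <= `|M i k| * (`|y i 0| - `|x k 0|) ^+ 2 by rewrite mulr_ge0 ?sqr_ge0.
  lra.
under eq_bigr do rewrite big_split /= -!mulr_sumr -mulr_suml.
rewrite big_split /= -!mulr_sumr exchange_big /=.
under [X in _ + _ * X <= _]eq_bigr do rewrite -mulr_suml.
have row_le : \sum_i (\sum_k `|M i k|) * y i 0 ^+ 2 <= c * nsq y.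
  by rewrite nsqE mulr_sumr; apply: ler_sum => i _; rewrite ler_wpM2r ?sqr_ge0.
have col_le : \sum_k (\sum_i `|M i k|) * x k 0 ^+ 2 <= c * nsq x.
  by rewrite nsqE mulr_sumr; apply: ler_sum => k _; rewrite ler_wpM2r ?sqr_ge0.
lra.
Qed.

End masks.
Section lattice_distance.
Context (d q : nat).
Implicit Types (j k l : lattice d q).

Lemma dist_linfC j k : dist_linf j k = dist_linf k j.
Proof. by apply: eq_bigr => i _; rewrite distnC. Qed.

Lemma dist_linf_leP j k m :
  reflect (forall i, `|(j i)%:Z - (k i)%:Z| <= m)%N (dist_linf j k <= m)%N.
Proof. by apply: (iffP (bigmax_leqP _ _ _)) => h i; [exact: h|move=> _; exact: h]. Qed.

Lemma dist_linf_triangle j k l :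
  (dist_linf j l <= dist_linf j k + dist_linf k l)%N.
Proof.
apply/dist_linf_leP => i; apply: leq_trans (leqD_dist _ (k i)%:Z _) _.
have /dist_linf_leP/(_ i) h1 := leqnn (dist_linf j k).
have /dist_linf_leP/(_ i) h2 := leqnn (dist_linf k l).
exact: leq_add.
Qed.

Lemma card_itv_ord lo hi : (#|[pred x : 'I_q | lo <= x < hi]| <= hi - lo)%N.
Proof.
rewrite cardE -(size_map val) -(size_iota lo (hi - lo)).
apply: uniq_leq_size; first by rewrite (map_inj_uniq val_inj) enum_uniq.
move=> _ /mapP[x + ->]; rewrite mem_enum inE mem_iota => /andP[h1 h2].
by rewrite /= h1 subnKC// (leq_trans h1)// ltnW.
Qed.

Lemma card_linf_ball j m :
  (#|[pred k | dist_linf k j <= m]| <= (2 * m).+1 ^ d)%N.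
Proof.
pose F (i : 'I_d) := [pred x : 'I_q | j i - m <= x < (j i + m).+1]%N.
apply: (@leq_trans #|family F|).
  apply: subset_leq_card; apply/fintype.subsetP => k; rewrite inE => /dist_linf_leP h.
  apply/familyP => i; rewrite inE; have := h i; lia.
rewrite card_family foldrE big_map -[X in (_ <= _ ^ X)%N](card_ord d) -prod_nat_const.
rewrite enumT; apply: leq_prod => i _.
apply: leq_trans (card_itv_ord _ _) _; lia.
Qed.

End lattice_distance.

Section lattice_blocks.
Context (d p b : nat).
Hypothesis b0 : (0 < b)%N.

Lemma block_coord_lt (x : 'I_p) : (x %/ b < nblocks p b)%N.
Proof.
rewrite /nblocks ltn_divLR//; apply: leq_trans (ltn_ord x) _.
have := ltn_ceil (p + b.-1) b0; rewrite mulSn; lia.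
Qed.

Definition block_of (t : lattice d p) : block_index d p b :=
  [ffun i => Ordinal (block_coord_lt (t i))].

Lemma mem_block (t : lattice d p) j : (t \in block j) = (j == block_of t).
Proof.
rewrite inE; apply/forallP/eqP => [h|-> i].
  apply/ffunP => i; apply/val_inj; rewrite ffunE /=.
  have := h i; rewrite inE => /andP[h1 h2].
  by apply/eqP; rewrite eqn_leq leq_divRL// h1 /= -ltnS ltn_divLR.
rewrite inE ffunE /= leq_trunc_div/= -ltn_divLR//.
Qed.

Lemma mem_window (t : lattice d p) (j : block_index d p b) :
  (t \in window j) = (dist_linf (block_of t) j <= 2)%N.
Proof.
apply/bigcupP/idP => [[k kj]|tj]; first by rewrite mem_block => /eqP <-.
by exists (block_of t) => //; rewrite mem_block.
Qed.

(** Contrapositive: each coordinate gap is at most the l1 distance, and integers less than [b] apart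
    have quotients by [b] at most 1 apart. *)
Lemma dist_far_blocks (t t' : lattice d p) :
  (1 < dist_linf (block_of t) (block_of t'))%N -> (b <= dist_l1 t t')%N.
Proof.
rewrite ltnNge; apply: contraR; rewrite -ltnNge => tb; apply/dist_linf_leP => i.
have {tb} : (`|(t i)%:Z - (t' i)%:Z| < b)%N.
  by apply: leq_ltn_trans tb; rewrite /dist_l1 (bigD1 i)//= leq_addr.
rewrite !ffunE /=; set x := (t i : nat); set y := (t' i : nat) => xy.
have h (u v : nat) : (`|u%:Z - v%:Z| < b)%N -> (u %/ b <= (v %/ b).+1)%N.
  move=> uv; have -> : (v %/ b).+1 = ((v + b) %/ b)%N.
    by rewrite divnDr ?dvdnn// divnn b0 addn1.
  apply: leq_div2r; lia.
have h1 := h _ _ xy; have h2 := h y x; rewrite distnC in h2; have {}h2 := h2 xy.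
lia.
Qed.

Lemma card_block (j : block_index d p b) : (#|block j| <= b ^ d)%N.
Proof.
pose F (i : 'I_d) := [pred x : 'I_p | j i * b <= x < (j i).+1 * b]%N.
apply: (@leq_trans #|family F|).
  apply: subset_leq_card; apply/fintype.subsetP => k; rewrite inE => /forallP h.
  by apply/familyP => i; have := h i; rewrite inE.
rewrite card_family foldrE big_map -[X in (_ <= _ ^ X)%N](card_ord d) -prod_nat_const.
rewrite enumT; apply: leq_prod => i _.
by apply: leq_trans (card_itv_ord _ _ _) _; rewrite mulSn addnK.
Qed.

Lemma card_window (j : block_index d p b) : (#|window j| <= 5 ^ d * b ^ d)%N.
Proof.
apply: (@leq_trans (\sum_(k | (dist_linf k j <= 2)%N) #|block k|)).
  apply: (big_ind2 (fun (A : {set lattice d p}) m => #|A| <= m)%N) => //.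
    by rewrite cards0.
  move=> A m B n hA hB; apply: leq_trans (leq_card_setU _ _) _; exact: leq_add.
apply: (@leq_trans (\sum_(k | (dist_linf k j <= 2)%N) b ^ d)).
  by apply: leq_sum => k _; exact: card_block.
rewrite sum_nat_const leq_mul2r; apply/orP; right.
exact: (card_linf_ball j 2).
Qed.

End lattice_blocks.
Section estimator_error.
Context (R : realType) (d p N b : nat) (Omega : operator R (lattice d p)).
Hypotheses (p0 : (0 < p)%N) (N0 : (0 < N)%N) (b0 : (0 < b)%N).
Hypothesis decO : decay_class Omega.
Hypothesis NkapO : N%:R * condition_number Omega <= expR b%:R.
Let om := opnorm Omega.
Let kappa := condition_number Omega.
Let pO : posdef Omega := proj1 decO.

Lemma lattice_card_gt0 : (0 < #|{: lattice d p}|)%N.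
Proof. by apply/card_gt0P; exists [ffun _ => Ordinal p0]. Qed.

Let om0 : 0 < om := posdef_opnorm_gt0 lattice_card_gt0 pO.

Let kappa1 : 1 <= kappa := condition_number_ge1 lattice_card_gt0 pO.

Lemma decay_mask_row (m : rel (lattice d p)) i :
  (forall t t', m t t' -> (b <= dist_l1 t t')%N) ->
  \sum_k `|mask m Omega i k| <= om * expR (- b%:R).
Proof.
move=> mb; have [_ /(_ b%:R (enum_val i))] := decO.
rewrite ltr0n => /(_ b0); apply: le_trans.
pose G t' := if b%:R <= (dist_l1 t' (enum_val i))%:R :> R
             then `|entry Omega (enum_val i) t'| else 0.
rewrite [leRHS]big_mkcond -/(G _) /= (big_enum_val (A := mem {: lattice d p}) G).
apply: ler_sum => k _; rewrite mxE /G; case: ifPn => [/mb mik|_].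
  rewrite ler_nat /dist_l1; under eq_bigr do rewrite distnC.
  by rewrite -/(dist_l1 _ _) mik /entry !enum_valK.
by rewrite normr0; case: ifP.
Qed.

(** The class controls rows; by symmetry of [Omega], columns are rows for the transposed
    relation. *)
Lemma decay_mask (m : rel (lattice d p)) :
  (forall t t', m t t' -> (b <= dist_l1 t t')%N) ->
  forall x y, dotp y (mask m Omega *m x) <= om * expR (- b%:R) / 2 * (nsq y + nsq x).
Proof.
move=> mb; apply: schur_test => i; first exact: decay_mask_row.
have sO i' k : Omega i' k = Omega k i' by rewrite -[in LHS](posdef_sym pO) mxE.
rewrite (eq_bigr (fun k => `|mask (fun t t' => m t' t) Omega i k|)) => [|k _].
  apply: decay_mask_row => t t' /mb; rewrite /dist_l1.
  by under eq_bigr do rewrite distnC.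
by rewrite !mxE sO.
Qed.

Lemma expRNb_le : expR (- b%:R) * kappa <= N%:R^-1 :> R.
Proof.
rewrite expRN mulrC ler_pdivrMr ?expR_gt0// mulrC ler_pdivlMr ?ltr0n//.
by rewrite mulrC.
Qed.

Context (z : 'I_N -> lattice d p -> R).

Let near (j : block_index d p b) : pred (lattice d p) :=
  fun t => (dist_linf j (block_of b0 t) <= 1)%N.

Let F (j : block_index d p b) := sel R (window j).

Definition sample_cov_mx : operator R (lattice d p) :=
  \matrix_(i, k) sample_cov z (enum_val i) (enum_val k).

Lemma local_covE j : local_cov z j = F j *m sample_cov_mx *m (F j)^T.
Proof. by apply/matrixP => a c; rewrite mul_sel_tr sel_mul !mxE !enum_rankK. Qed.

Lemma Omega_tildeE : Omega_tilde b z =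
  \sum_j mask (fun t t' => (j == block_of b0 t) && near j t')
    ((F j)^T *m invmx (local_cov z j) *m F j).
Proof.
apply/matrixP => i k; rewrite mxE summxE; apply: eq_bigr => j _.
rewrite mxE -sub_entryE mem_block.
under eq_bigr do rewrite (mem_block b0).
case: eqP => [_|_] /=; last by rewrite big1.
rewrite -big_mkcondr /near; case: ifPn => [h|h].
  by rewrite (eq_bigl (pred1 (block_of b0 (enum_val k)))) ?big_pred1_eq// => j' /=;
    apply/andP/eqP => [[_ /eqP]|->].
rewrite big_pred0// => j'; apply: contraNF h => /andP[+ /eqP <-] //.
Qed.

(** The last mask is what the estimator replaces by 0; the other terms match those of [Omega_tildeE]
    one block row at a time. *)
Lemma mask_blocks_sum (A : operator R (lattice d p)) :
  A = \sum_j mask (fun t t' => (j == block_of b0 t) && near j t') A +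
      mask (fun t t' => 1 < dist_linf (block_of b0 t) (block_of b0 t'))%N A.
Proof.
apply/matrixP => i k; rewrite mxE summxE mxE (bigD1 (block_of b0 (enum_val i)))//=.
rewrite big1 => [|j /negbTE ji]; last by rewrite mxE ji.
by rewrite mxE eqxx /= /near addr0 ltnNge; case: ifP; rewrite ?addr0 ?add0r.
Qed.

Lemma sum_nsq_own (y : 'cV[R]_#|{: lattice d p}|) :
  \sum_j nsq (proj (fun t => j == block_of b0 t) y) = nsq y.
Proof.
under eq_bigr do rewrite nsq_proj; rewrite exchange_big nsqE; apply: eq_bigr => i _.
rewrite (bigD1 (block_of b0 (enum_val i)))//= eqxx mul1r big1 ?addr0// => j /negbTE ->.
by rewrite mul0r.
Qed.

(** A coordinate is counted once for each block adjacent to or equal to its own. *)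
Lemma sum_nsq_near (x : 'cV[R]_#|{: lattice d p}|) :
  \sum_j nsq (proj (near j) x) <= 3 ^+ d * nsq x.
Proof.
under eq_bigr do rewrite nsq_proj; rewrite exchange_big nsqE mulr_sumr.
apply: ler_sum => i _; rewrite -mulr_suml ler_wpM2r ?sqr_ge0//.
rewrite -natr_sum -natrX ler_nat.
rewrite (eq_bigr (fun j => if near j (enum_val i) then 1 else 0)%N) => [|j _].
  rewrite -big_mkcond sum1_card.
  apply: leq_trans (card_linf_ball (block_of b0 (enum_val i)) 1).
  by rewrite leq_eqVlt; apply/orP; left; apply/eqP/eq_card => j; rewrite !inE.
by case: (near _ _).
Qed.

Lemma estimator_error (e : R) : 0 <= e -> e <= 2^-1 ->
  (forall j u, `|dotp u ((local_cov z j - F j *m invmx Omega *m (F j)^T) *m u)| <=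
    e * dotp u (F j *m invmx Omega *m (F j)^T *m u)) ->
  well_defined b z /\
  opnorm (Omega_hat b z - Omega) <=
    om * (2 * (3 ^+ d * (2 * e + (2 * N%:R)^-1) + (2 * N%:R)^-1)).
Proof.
move=> e0 e2 H.
have sSc (j : block_index d p b) : (local_cov z j)^T = local_cov z j.
  apply/matrixP => a c; rewrite !mxE /sample_cov; congr (_ * _).
  by apply: eq_bigr => n _; rewrite mulrC.
have var j x y := local_variance (sel_sel_tr R (window j)) pO lattice_card_gt0
  x y (sSc j) e0 e2 (H j).
split; first by move=> j; have [] := var j 0 0.
have kap0 : 0 < kappa := lt_le_trans ltr01 kappa1.
have N0R : 0 < N%:R :> R by rewrite ltr0n.
have local j x y : dotp (proj (fun t => j == block_of b0 t) y)
    (((F j)^T *m invmx (local_cov z j) *m F j - Omega) *m proj (near j) x) <=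
    om * (2 * e + (2 * N%:R)^-1) *
    (nsq (proj (fun t => j == block_of b0 t) y) + nsq (proj (near j) x)).
  set y' := proj _ y; set x' := proj _ x.
  have Fy : (F j)^T *m (F j *m y') = y'.
    apply: sel_support => c; rewrite (mem_window b0) mxE; case: eqP => // ->.
    by rewrite (_ : dist_linf _ _ = 0%N)//; apply/eqP; rewrite -leqn0;
      apply/dist_linf_leP => i; rewrite distnn.
  have Fx : (F j)^T *m (F j *m x') = x'.
    apply: sel_support => c; rewrite (mem_window b0) mxE /near dist_linfC.
    by case: ifP => // h; rewrite (leq_trans h).
  (* This weight equalizes the two terms of the bias: [c kappa^2] and [(om e^-b)^2 / c] are both
     [om e^-b kappa]. *)
  pose c := om * expR (- b%:R) / kappa.
  have c0 : 0 < c by rewrite divr_gt0// mulr_gt0// expR_gt0.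
  have bias := local_bias (sel_sel_tr R (window j)) pO lattice_card_gt0 c0 Fx Fy.
  have [_ v] := var j x' y'.
  set z' := (X in _^-1 * nsq X) in bias.
  have z'E : z' = mask (fun t t' => (t \notin window j) && near j t') Omega *m x'.
    apply/colP => i; rewrite /z' /F [LHS]mxE [X in _ + X]mxE sel_tr_sel.
    case: ifPn => iW; rewrite ?subrr ?subr0 !mxE.
      by rewrite big1// => k _; rewrite !mxE iW /= mul0r.
    apply: eq_bigr => k _; rewrite !mxE iW /=.
    by case: (near _ _); rewrite ?mulr0.
  have nz : nsq z' <= (om * expR (- b%:R)) ^+ 2 * nsq x'.
    rewrite z'E -[om * _ in leRHS](divfK (_ : 2 != 0)) ?pnatr_eq0// [_ / 2 * 2]mulrC.
    apply: nsq_mulmx_le_bilinear.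
      by rewrite divr_ge0// mulr_ge0 ?opnorm_ge0 ?expR_ge0.
    (* Outside the window the block distance to [j] is at least 3, on the near blocks at most 1; the
       triangle inequality leaves the required 2. *)
    apply: decay_mask => t t' /andP[tW tQ]; apply: (dist_far_blocks (b0 := b0)).
    move: tW; rewrite (mem_window b0) -ltnNge => tW.
    have := leq_trans tW (dist_linf_triangle _ (block_of b0 t') _).
    move: tQ; rewrite /near (dist_linfC j) => tQ h; rewrite -(ltn_add2r 1).
    by apply: leq_trans h _; rewrite leq_add2l.
  have bias2 : dotp y' (((F j)^T *m invmx (F j *m invmx Omega *m (F j)^T) *m F j -
      Omega) *m x') <= om * (2 * N%:R)^-1 * (nsq y' + nsq x').
    have e1 : c * (condition_number Omega ^+ 2 * nsq y') =
        om * (expR (- b%:R) * kappa) * nsq y'.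
      by rewrite /c -/kappa; field; rewrite gt_eqF.
    have e3 : c^-1 * ((om * expR (- b%:R)) ^+ 2 * nsq x') =
        om * (expR (- b%:R) * kappa) * nsq x'.
      by rewrite /c; field; rewrite !gt_eqF ?expR_gt0.
    have e4 : c^-1 * nsq z' <= om * (expR (- b%:R) * kappa) * nsq x'.
      by rewrite -e3 ler_wpM2l// invr_ge0 ltW.
    rewrite e1 in bias.
    have : om * (expR (- b%:R) * kappa) * (nsq y' + nsq x') <=
        om * N%:R^-1 * (nsq y' + nsq x').
      by rewrite ler_wpM2r ?addr_ge0 ?nsq_ge0// ler_wpM2l ?expRNb_le// ltW.
    rewrite invfM; lra.
  rewrite -[X in X - Omega](subrK ((F j)^T *m invmx (F j *m invmx Omega *m (F j)^T) *m F j)).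
  rewrite -addrA mulmxDl dotpDr; move: v bias2; rewrite -/om; lra.
pose K := om * (3 ^+ d * (2 * e + (2 * N%:R)^-1) + (2 * N%:R)^-1).
have tilde x y : dotp y ((Omega_tilde b z - Omega) *m x) <= K * (nsq y + nsq x).
  rewrite Omega_tildeE [in X in _ - X](mask_blocks_sum Omega) opprD addrA -sumrB.
  rewrite mulmxBl dotpBr mulmx_suml dotp_sumr.
  set far := mask _ Omega.
  have hfar : - dotp y (far *m x) <= om * (2 * N%:R)^-1 * (nsq y + nsq x).
    have := @decay_mask (fun t t' =>
      (1 < dist_linf (block_of b0 t) (block_of b0 t'))%N) _ x (- y).
    rewrite dotpNl nsqN -/far => /(_ (fun t t' => @dist_far_blocks _ _ _ b0 t t')).
    move/le_trans; apply; rewrite ler_wpM2r ?addr_ge0 ?nsq_ge0//.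
    have : om * expR (- b%:R) <= om * N%:R^-1.
      rewrite ler_wpM2l ?(ltW om0)//; apply: le_trans expRNb_le.
      by rewrite ler_peMr ?expR_ge0.
    by rewrite invfM; lra.
  have hsum : \sum_j dotp y ((mask (fun t t' => (j == block_of b0 t) && near j t')
       ((F j)^T *m invmx (local_cov z j) *m F j) -
       mask (fun t t' => (j == block_of b0 t) && near j t') Omega) *m x) <=
      om * (2 * e + (2 * N%:R)^-1) * (3 ^+ d * (nsq y + nsq x)).
    apply: (@le_trans _ _ (\sum_j om * (2 * e + (2 * N%:R)^-1) *
        (nsq (proj (fun t => j == block_of b0 t) y) + nsq (proj (near j) x)))).
      (* Masking the matrix amounts to cutting both vectors, which is the setting of [local]. *)
      apply: ler_sum => j _; rewrite mulmxBl dotpBr !dotp_mask -dotpBr -mulmxBl.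
      exact: local.
    rewrite -mulr_sumr big_split /= sum_nsq_own; apply: ler_wpM2l.
      by rewrite mulr_ge0 ?opnorm_ge0// addr_ge0 ?mulr_ge0// invr_ge0 mulr_ge0.
    rewrite mulrDr; apply: lerD; last exact: sum_nsq_near.
    by rewrite ler_peMl ?nsq_ge0// exprn_ege1// ler1n.
  apply: le_trans (lerD hsum hfar) _; rewrite /K; lra.
have K0 : 0 <= K.
  by rewrite mulr_ge0 ?opnorm_ge0// !(addr_ge0, mulr_ge0, exprn_ge0, invr_ge0).
rewrite mulrCA -/K; apply: opnorm_le_bilinear => // x y.
have -> : Omega_hat b z - Omega =
    2^-1 *: ((Omega_tilde b z - Omega) + (Omega_tilde b z - Omega)^T).
  rewrite /Omega_hat linearB /= (posdef_sym pO) addrACA -opprD scalerBr.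
  congr (_ - _); rewrite scalerDr -scalerDl (_ : 2^-1 + 2^-1 = 1) ?scale1r//.
  by field.
rewrite -scalemxAl dotpZr mulmxDl dotpDr.
(* The bound is symmetric in [x] and [y], so it passes to the transpose and to the average. *)
have := tilde x y; have := tilde y x.
rewrite (dotpC x) dotp_mulmx (addrC (nsq x)); lra.
Qed.

End estimator_error.
(** * Concentration of the local covariances *)

Section gaussian_concentration.
Local Open Scope classical_set_scope.
Context (R : realType) (I : finType) (N : nat) (Sigma : operator R I).
Context (disp : measure_display) (T : measurableType disp) (P : probability T R).
Context (Z : 'I_N -> I -> {RV P >-> R}).
Hypothesis gZ : iid_gaussian Sigma Z.

Definition linear_form (u : 'cV[R]_#|{: I}|) (x : I -> R) : R :=
  \sum_(t : I) u (enum_rank t) 0 * x t.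

(** Brings events on one linear form within reach of [independent_vectors], which is stated for the
    cylinder sigma-algebra. *)
Lemma measurable_linear_form u B : measurable B ->
  <<s @cylinders R I >> [set x | B (linear_form u x)].
Proof.
move=> mB.
(* [measurableTypeR R], unlike [R], is canonically pointed *)
pose G : set (set (I -> measurableTypeR R)) := @cylinders R I.
have mcoord t : measurable_fun setT (fun x : g_sigma_algebraType G => (x t : R)).
  by move=> _ C mC; rewrite setTI; apply: sub_sigma_algebra; exists t; exists C.
have : measurable_fun setT (fun x : g_sigma_algebraType G => linear_form u x).
  by apply: measurable_fun_sum => t; exact: measurable_funM.
by move=> /(_ measurableT B mB); rewrite setTI.
Qed.

Lemma measurable_form_RV u n :
  measurable_fun setT (fun w => linear_form u (fun t => Z n t w)).
Proof. by apply: measurable_fun_sum => t; exact: measurable_funM. Qed.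

Lemma gaussian_form_tail u t : 0 < dotp u (Sigma *m u) -> 0 <= t -> t <= 2 ->
  (P [set w | (N%:R * t <= `|\sum_(n < N)
      (linear_form u (fun t => Z n t w) ^+ 2 / dotp u (Sigma *m u) - 1)|)%R] <=
   (2 * expR (- (N%:R * t ^+ 2 / 16)))%:E)%E.
Proof.
move=> s0 t0 t2; have [gaussZ indepZ] := gZ.
pose Y n : {RV P >-> R} := HB.pack_for {mfun T >-> R}
  (fun w => linear_form u (fun t => Z n t w))
  (isMeasurableFun.Build _ _ _ _ _ (measurable_form_RV u n)).
have sq : Num.sqrt (dotp u (Sigma *m u)) ^+ 2 = dotp u (Sigma *m u).
  by rewrite sqr_sqrtr// ltW.
have u0 : u != 0 by apply: contraTneq s0 => ->; rewrite mulmx0 dotp0r ltxx.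
have := @chi_square_tail _ _ _ P N Y (Num.sqrt (dotp u (Sigma *m u))).
rewrite sq sqrtr_gt0; apply => //.
  move=> B mB; exact: (indepZ (fun n => [set x | B n (linear_form u x)])
    (fun n => measurable_linear_form u (mB n))).
move=> n B mB; rewrite dotpE mulmxA; exact: gaussZ.
Qed.

Lemma measurable_gaussian_form_tail u t s : measurable
  [set w | (t <= `|\sum_(n < N) (linear_form u (fun t => Z n t w) ^+ 2 / s - 1)|)%R].
Proof.
rewrite -[X in measurable X]setTI; apply: measurable_fun_le => //.
apply: measurableT_comp => //; apply: measurable_fun_sum => n.
apply: measurable_funB => //; apply: measurable_funM => //; apply: measurable_funX.
exact: measurable_form_RV.
Qed.

End gaussian_concentration.

Section union_bound.
Local Open Scope classical_set_scope.
Context (R : realType) d (T : measurableType d) (P : {measure set T -> \bar R}).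

Lemma measure_bigcup_finset_le (J : finType) (D : {pred J}) (A : J -> set T) (c : R) :
  (forall j, measurable (A j)) -> (forall j, D j -> (P (A j) <= c%:E)%E) ->
  (P (\big[setU/set0]_(j | D j) A j) <= (#|D|%:R * c)%:E)%E.
Proof.
move=> mA Ac; rewrite -sum1_card natr_sum mulr_suml -sumEFin.
apply: (@le_trans _ _ (\sum_(j | D j) P (A j))%E).
  apply: (proj2 (A := measurable (\big[setU/set0]_(j | D j) A j))).
  apply: (big_ind2 (fun B x => measurable B /\ (P B <= x)%E)).
  - by rewrite measure0.
  - move=> B x C y [mB hB] [mC hC]; split; first exact: measurableU.
    by apply: (le_trans (measureU2 _ _ _)) => //; exact: leeD.
  - by move=> j _.
by apply: lee_sum => j Dj; rewrite mul1r; exact: Ac.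
Qed.

End union_bound.

Section local_concentration.
Local Open Scope classical_set_scope.
Context (R : realType) (d p N : nat) (Omega : operator R (lattice d p)).
Context (disp : measure_display) (T : measurableType disp) (P : probability T R).
Context (Z : 'I_N -> lattice d p -> {RV P >-> R}).
Hypotheses (p0 : (0 < p)%N) (N0 : (0 < N)%N) (pO : posdef Omega).
Hypothesis gZ : iid_gaussian (invmx Omega) Z.

Lemma dotp_sample_cov (z : 'I_N -> lattice d p -> R) u :
  dotp u (sample_cov_mx z *m u) = N%:R^-1 * \sum_(n < N) linear_form u (z n) ^+ 2.
Proof.
rewrite dotp_mulmxE.
have lf n : linear_form u (z n) = \sum_i u i 0 * z n (enum_val i).
  rewrite /linear_form (big_enum_val (A := mem {: lattice d p})
    (fun t => u (enum_rank t) 0 * z n t)).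
  by apply: eq_bigr => i _; rewrite enum_valK.
under [in RHS]eq_bigr do rewrite lf expr2 mulr_suml.
rewrite [in RHS]exchange_big mulr_sumr; apply: eq_bigr => i _.
under [in RHS]eq_bigr do rewrite mulr_sumr.
rewrite [in RHS]exchange_big mulr_sumr; apply: eq_bigr => k _.
rewrite mxE /sample_cov !mulr_sumr mulr_suml; apply: eq_bigr => n _; ring.
Qed.

(** Failure for some [u] is a union over all vectors; [Bad], a finite measurable union over the net,
    contains it. The factor 3 is that of [net_quadratic_le]. *)
Lemma local_cov_concentration b (j : block_index d p b) t : 0 <= t -> t <= 2 ->
  let A := sel R (window j) *m invmx Omega *m (sel R (window j))^T in
  exists2 Bad : set T, measurable Bad /\
    (P Bad <= (2 ^+ (18 * #|window j|) * (2 * expR (- (N%:R * t ^+ 2 / 16))))%:E)%E &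
    forall w, ~ Bad w -> forall u,
      `|dotp u ((local_cov (fun n t => Z n t w) j - A) *m u)| <=
      3 * t * dotp u (A *m u).
Proof.
move=> t0 t2 A; set F := sel R (window j).
have n0 : (0 < #|{: lattice d p}|)%N := lattice_card_gt0 d p0.
have pA : posdef A := local_cov_posdef (sel_sel_tr R (window j)) pO n0.
have [D uD DAD] := posdef_whitening pA.
have congrE (X : 'M[R]_#|window j|) v :
    dotp v (D^T *m X *m D *m v) = dotp (D *m v) (X *m (D *m v)).
  by rewrite dotp_mulmx !mulmxA.
have nsqE v : nsq v = dotp (D *m v) (A *m (D *m v)).
  by rewrite -congrE DAD mul1mx.
(* Whitening gives the linear form of [uf f] the variance [|f|^2], so each grid point tests one
   chi-square sum. *)
pose uf f : 'cV[R]_#|{: lattice d p}| := F^T *m (D *m grid_point R f).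
have ufE (X : operator R (lattice d p)) f : dotp (uf f) (X *m uf f) =
    dotp (D *m grid_point R f) (F *m X *m F^T *m (D *m grid_point R f)).
  by rewrite {1}/uf dotp_mulmx trmxK /uf !mulmxA.
have uS f : dotp (uf f) (invmx Omega *m uf f) = nsq (grid_point R f).
  by rewrite ufE nsqE.
(* At the zero point there is no variance to divide by and the form vanishes, so nothing can
   fail. *)
pose B f := if nsq (grid_point R f) == 0 then set0 else
  [set w | (N%:R * t <= `|\sum_(n < N)
    (linear_form (uf f) (fun t => Z n t w) ^+ 2 / nsq (grid_point R f) - 1)|)%R].
have mB f : measurable (B f).
  by rewrite /B; case: ifP => // _; exact: measurable_gaussian_form_tail.
exists (\big[setU/set0]_(f | f \in grid_net R #|window j|) B f).
  split; first by apply: bigsetU_measurable => f _; exact: mB.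
  apply: le_trans (measure_bigcup_finset_le (D := mem (grid_net R #|window j|))
    (c := 2 * expR (- (N%:R * t ^+ 2 / 16))) mB _) _.
    move=> f _; rewrite /B; case: ifPn => nf.
      by rewrite measure0 lee_fin mulr_ge0 ?expR_ge0.
    rewrite -(uS f); apply: gaussian_form_tail => //.
    by rewrite uS lt_neqAle eq_sym nf nsq_ge0.
  rewrite lee_fin ler_wpM2r ?mulr_ge0 ?expR_ge0//.
  by rewrite -natrX ler_nat card_grid_net.
move=> w nB u; set S := sample_cov_mx (fun n t => Z n t w).
rewrite local_covE -/F -/S.
pose M := D^T *m (F *m S *m F^T - A) *m D.
have sM : M^T = M.
  have sS : S^T = S.
    apply/matrixP => i k; rewrite !mxE /sample_cov; congr (_ * _).
    by apply: eq_bigr => n _; rewrite mulrC.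
  have sL : (F *m S *m F^T)^T = F *m S *m F^T by rewrite !trmx_mul trmxK sS mulmxA.
  by rewrite /M !trmx_mul trmxK linearB /= sL (posdef_sym pA) mulmxA.
have netM f : f \in grid_net R #|window j| ->
    `|dotp (grid_point R f) (M *m grid_point R f)| <= t * nsq (grid_point R f).
  move=> fnet; rewrite congrE mulmxBl dotpBr -ufE -nsqE.
  have [nf|nf] := boolP (nsq (grid_point R f) == 0).
    have /eqP g0 : grid_point R f == 0 by rewrite -nsq_eq0.
    by rewrite /uf g0 !mulmx0 dotp0r /nsq dotp0r subrr normr0 mulr0.
  have g0 : 0 < nsq (grid_point R f) by rewrite lt_neqAle eq_sym nf nsq_ge0.
  have : ~ B f w by move=> Bf; apply: nB; rewrite (bigD1 f)//=; left.
  rewrite /B (negbTE nf) /= => /negP; rewrite -ltNge sumrB sumr_const card_ord.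
  rewrite -mulr_suml dotp_sample_cov.
  set q := \sum_(n < N) _; set g := nsq _ in g0 *.
  have N0R : 0 < N%:R :> R by rewrite ltr0n.
  have -> : N%:R^-1 * q - g = (g / N%:R) * (q / g - 1 *+ N).
    by rewrite -mulr_natr mul1r; field; rewrite !gt_eqF.
  move=> /ltW h; rewrite normrM gtr0_norm ?divr_gt0//.
  have <- : g / N%:R * (N%:R * t) = t * g by field; rewrite gt_eqF.
  by rewrite ler_wpM2l// divr_ge0// ltW.
(* Evaluating at [D^-1 u] undoes the whitening. *)
have := net_quadratic_le sM t0 netM (invmx D *m u).
by rewrite congrE nsqE mulKVmx.
Qed.

End local_concentration.
(** * Measurability of the estimator *)

Section measurable_matrices.
Local Open Scope classical_set_scope.
Context (R : realType) d (T : measurableType d).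

Definition measurable_mx m n (M : T -> 'M[R]_(m, n)) :=
  forall i k, measurable_fun setT (fun w => M w i k).

(** The formula [x * (x^2)^-1] involves only the power of a nonnegative number and is also right at
    0, where the inverse is 0. *)
Lemma measurable_fun_inv (f : T -> R) :
  measurable_fun setT f -> measurable_fun setT (fun w => (f w)^-1).
Proof.
move=> mf; rewrite (_ : (fun w => _) = fun w => f w * ((f w ^+ 2) `^ (-1))).
  apply: measurable_funM => //.
  by apply: (measurableT_comp (@measurable_powR R (-1))); exact: measurable_funX.
apply/funext => w; rewrite powR_inv1 ?sqr_ge0//.
have [->|f0] := eqVneq (f w) 0; first by rewrite invr0 mul0r.
by rewrite expr2 invfM mulVKf.
Qed.

Lemma measurable_det n (M : T -> 'M[R]_n) :
  measurable_mx M -> measurable_fun setT (fun w => \det (M w)).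
Proof.
move=> mM; apply: measurable_fun_sum => s; apply: measurable_funM => //.
by apply: measurable_fun_prod.
Qed.

Lemma measurable_unitmx n (M : T -> 'M[R]_n) :
  measurable_mx M -> measurable [set w | M w \in unitmx].
Proof.
move=> mM; rewrite (_ : [set w | _] = ~` ((fun w => \det (M w)) @^-1` [set 0])).
  apply: measurableC; rewrite -[X in measurable X]setTI.
  by apply: measurable_det => //; exact: measurable_set1.
by apply/seteqP; split => w /=; rewrite unitmxE unitfE => /eqP.
Qed.

(** Cramer's rule, except on singular matrices, which [invmx] returns unchanged. *)
Lemma measurable_invmx n (M : T -> 'M[R]_n) :
  measurable_mx M -> measurable_mx (fun w => invmx (M w)).
Proof.
move=> mM i k.
rewrite (_ : (fun w => _) = fun w => if \det (M w) == 0 then M w i k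
    else (\det (M w))^-1 * cofactor (M w) k i); last first.
  apply/funext => w; rewrite /invmx unitmxE unitfE.
  by case: eqP => //= _; rewrite !mxE.
apply: measurable_fun_ifT => //.
  by apply: measurable_fun_eqr => //; exact: measurable_det.
apply: measurable_funM; first exact/measurable_fun_inv/measurable_det.
apply: measurable_funM => //; apply: measurable_det => a c.
rewrite (_ : (fun w => _) = fun w => M w (lift k a) (lift i c)) //.
by apply/funext => w; rewrite !mxE.
Qed.

Lemma l2norm_ge0 m (x : 'cV[R]_m) : 0 <= l2norm x.
Proof. exact: sqrtr_ge0. Qed.

Lemma l2normD m (x y : 'cV[R]_m) : l2norm (x + y) <= l2norm x + l2norm y.
Proof.
have xy : dotp x y <= Num.sqrt (nsq x) * Num.sqrt (nsq y).
  rewrite -sqrtrM ?nsq_ge0//; apply: le_trans (ler_norm _) _.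
  by rewrite -sqrtr_sqr ler_sqrt ?dotp_sqr_le// mulr_ge0 ?nsq_ge0.
rewrite -(@ler_pXn2r _ 2) ?nnegrE ?addr_ge0 ?l2norm_ge0//.
rewrite sqrrD !l2normE !sqr_sqrtr ?nsq_ge0// nsqD lerD2r lerD2l; lra.
Qed.

Lemma l2normZ m a (x : 'cV[R]_m) : 0 <= a -> l2norm (a *: x) = a * l2norm x.
Proof.
by move=> a0; rewrite !l2normE nsqZ sqrtrM ?sqr_ge0// sqrtr_sqr ger0_norm.
Qed.

(** Taking floors in [s x] moves it by at most [sqrt n] whatever [s] is, which is negligible after
    division by a large [s]. A countable set of test vectors is what makes the norm event
    measurable. *)
Lemma opnorm_le_integer n (A : 'M[R]_n) (c : R) : 0 <= c ->
  (forall k : 'cV[int]_n, l2norm (A *m map_mx intr k) <= c * l2norm (map_mx intr k)) ->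
  opnorm A <= c.
Proof.
move=> c0 h.
have frac (x : 'cV[R]_n) : exists k : 'cV[int]_n,
    l2norm (x - map_mx intr k) <= Num.sqrt n%:R.
  exists (\col_i Num.floor (x i 0)); rewrite l2normE ler_sqrt//.
  rewrite nsqE -[n in leRHS]card_ord -sumr_const; apply: ler_sum => i _.
  rewrite !mxE; have := floor_itv (x i 0).
  move=> /andP[h1 h2]; rewrite intrD in h2.
  by rewrite expr_le1// ?subr_ge0//; lra.
have lA x : l2norm (A *m x) <= opnorm A * l2norm x.
  rewrite !l2normE -[opnorm A]ger0_norm ?opnorm_ge0// -sqrtr_sqr.
  by rewrite -sqrtrM ?sqr_ge0// ler_sqrt ?nsq_mulmx_le// mulr_ge0 ?sqr_ge0 ?nsq_ge0.
have hx x : l2norm (A *m x) <= c * l2norm x.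
  rewrite leNgt; apply/negP => lt.
  pose K := (c + opnorm A) * Num.sqrt n%:R.
  pose e := l2norm (A *m x) - c * l2norm x.
  have e0 : 0 < e by rewrite subr_gt0.
  (* So large that the scaled gap [s * e] exceeds [K], the total cost of rounding. *)
  pose s : R := (Num.truncn (K / e)).+1%:R.
  have s0 : 0 <= s by [].
  have Ks : K < s * e by rewrite -ltr_pdivrMr// truncnS_gt.
  have [k hk] := frac (s *: x).
  have h1 : s * l2norm (A *m x) <= l2norm (A *m map_mx intr k) +
      opnorm A * l2norm (s *: x - map_mx intr k).
    have eA : s *: (A *m x) = A *m map_mx intr k + A *m (s *: x - map_mx intr k).
      by rewrite scalemxAr -mulmxDr addrC subrK.
    by rewrite -(l2normZ _ s0) eA; apply: le_trans (l2normD _ _) _; rewrite lerD2l.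
  have h2 : l2norm (map_mx intr k) <= s * l2norm x + l2norm (s *: x - map_mx intr k).
    have ek : map_mx intr k = s *: x - (s *: x - map_mx intr k) by rewrite subKr.
    rewrite -(l2normZ _ s0) [X in l2norm X <= _]ek.
    by apply: le_trans (l2normD _ _) _; rewrite lerD2l !l2normE nsqN.
  have h3 : c * l2norm (map_mx intr k) <= c * (s * l2norm x + Num.sqrt n%:R).
    by rewrite ler_wpM2l//; apply: le_trans h2 _; rewrite lerD2l.
  have h4 : opnorm A * l2norm (s *: x - map_mx intr k) <= opnorm A * Num.sqrt n%:R.
    by rewrite ler_wpM2l ?opnorm_ge0.
  have := h k; move: Ks; rewrite /K /e; lra.
apply: opnorm_le => // x; have := hx x.
rewrite -(@ler_pXn2r _ 2) ?nnegrE ?mulr_ge0 ?l2norm_ge0//.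
by rewrite exprMn !l2normE !sqr_sqrtr ?nsq_ge0.
Qed.

Lemma measurable_opnorm_le n (M : T -> 'M[R]_n) (c : R) :
  measurable_mx M -> measurable [set w | opnorm (M w) <= c].
Proof.
move=> mM; have [c0|c0] := ltP c 0.
  rewrite (_ : [set w | _] = set0)//; apply/seteqP; split => // w /=.
  by rewrite leNgt (lt_le_trans c0 (opnorm_ge0 _)).
rewrite (_ : [set w | _] = ~` \bigcup_(k : 'cV[int]_n)
    ~` [set w | nsq (M w *m map_mx intr k) <= c ^+ 2 * nsq (map_mx intr k)]).
  apply: measurableC; apply: countable_bigcupT_measurable => // k.
  apply: measurableC; rewrite -[X in measurable X]setTI.
  apply: measurable_fun_le => //; apply: measurable_fun_sum => i.
  apply: measurable_funM.
    rewrite (_ : (fun w => _) = fun w => \sum_j M w i j * (map_mx intr k) j 0).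
      by apply: measurable_fun_sum => j; exact: measurable_funM.
    by apply/funext => w; rewrite mxE.
  rewrite (_ : (fun w => _) = fun w => \sum_j M w i j * (map_mx intr k) j 0).
    by apply: measurable_fun_sum => j; exact: measurable_funM.
  by apply/funext => w; rewrite mxE.
apply/seteqP; split => w /= h.
  move=> [k _]; apply; apply: le_trans (nsq_mulmx_le _ _) _.
  by rewrite ler_wpM2r ?nsq_ge0// ler_pXn2r ?nnegrE ?opnorm_ge0.
apply: opnorm_le_integer => // k.
have hk : nsq (M w *m map_mx intr k) <= c ^+ 2 * nsq (map_mx intr k).
  by apply: contrapT => nk; apply: h; exists k.
rewrite !l2normE -[c]ger0_norm// -sqrtr_sqr -sqrtrM ?sqr_ge0// ler_sqrt//.
by rewrite mulr_ge0 ?sqr_ge0 ?nsq_ge0.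
Qed.

End measurable_matrices.

Section measurable_estimator.
Local Open Scope classical_set_scope.
Context (R : realType) (d p N b : nat) (disp : measure_display).
Context (T : measurableType disp) (Z : 'I_N -> lattice d p -> T -> R).
Hypothesis mZ : forall n t, measurable_fun setT (Z n t).

Lemma measurable_local_cov (j : block_index d p b) :
  measurable_mx (fun w => local_cov (fun n t => Z n t w) j).
Proof.
move=> a c; rewrite (_ : (fun w => _) = fun w => N%:R^-1 *
    \sum_(n < N) Z n (enum_val a) w * Z n (enum_val c) w).
  apply: measurable_funM => //; apply: measurable_fun_sum => n.
  exact: measurable_funM.
by apply/funext => w; rewrite mxE.
Qed.

Lemma measurable_Omega_tilde :
  measurable_mx (fun w => Omega_tilde b (fun n t => Z n t w)).
Proof.
move=> i k; rewrite /Omega_tilde; under eq_fun do rewrite mxE.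
apply: measurable_fun_sum => j; apply: measurable_fun_sum => j'.
case: ((enum_val i \in block j) && (enum_val k \in block j')) => //.
apply: measurable_fun_sum => a; apply: measurable_fun_sum => c.
exact/measurable_invmx/measurable_local_cov.
Qed.

(** Monotonicity of [P], applied to a smaller good event, requires measurability of this one. *)
Lemma measurable_estimator_event (Omega : operator R (lattice d p)) (c : R) :
  measurable [set w | well_defined b (fun n t => Z n t w) /\
    opnorm (Omega_hat b (fun n t => Z n t w) - Omega) <= c].
Proof.
apply: measurableI.
  rewrite [X in measurable X](_ : _ = \bigcap_(j in [set: block_index d p b])
      [set w | local_cov (fun n t => Z n t w) j \in unitmx]).
    apply: fin_bigcap_measurable => // j _.
    exact/measurable_unitmx/measurable_local_cov.
  by apply/seteqP; split => w h j; [move=> _; exact: h|exact: (h j Logic.I)].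
apply: measurable_opnorm_le => i k.
rewrite (_ : (fun w => _) = fun w => 2^-1 *
  (Omega_tilde b (fun n t => Z n t w) i k + Omega_tilde b (fun n t => Z n t w) k i) -
  Omega i k).
  apply: measurable_funB => //; apply: measurable_funM => //.
  by apply: measurable_funD; exact: measurable_Omega_tilde.
apply/funext => w; rewrite /Omega_hat; move: (Omega_tilde b (fun n t => Z n t w)) => X.
by rewrite !mxE.
Qed.

End measurable_estimator.
(** * Choice of the constants *)

Section parameters.
Context (R : realType).

Lemma condition_number_1x1 n (A : 'M[R]_n) : n = 1%N -> posdef A ->
  condition_number A = 1.
Proof.
move=> n1; move: A; rewrite n1 => A pA; apply/le_anti.
rewrite condition_number_ge1// andbT.
have o1 (B : 'M[R]_1) : opnorm B <= `|B 0 0|.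
  apply: opnorm_le => // x; rewrite !nsqE !big_ord1 mxE big_ord1.
  by rewrite exprMn real_normK ?num_real.
rewrite /condition_number; apply: le_trans (ler_pM (opnorm_ge0 _) (opnorm_ge0 _) (o1 A) (o1 _)) _.
have : (A *m invmx A) 0 0 = 1 by rewrite mulmxV ?posdef_unitmx// mxE eqxx.
by rewrite mxE big_ord1 -normrM => ->; rewrite normr1.
Qed.

Lemma exprD_le_double (x y : R) d : 0 <= x -> 0 <= y ->
  (x + y) ^+ d <= 2 ^+ d * (x ^+ d + y ^+ d).
Proof.
move=> x0 y0; have xd := exprn_ge0 d x0; have yd := exprn_ge0 d y0.
wlog xy : x y x0 y0 xd yd / x <= y.
  move=> h; have [xy|/ltW yx] := leP x y; first exact: h.
  by rewrite addrC [X in _ * X]addrC; exact: h.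
apply: (@le_trans _ _ ((2 * y) ^+ d)).
  by rewrite lerXn2r ?nnegrE ?addr_ge0 ?mulr_ge0//; lra.
by rewrite exprMn ler_wpM2l ?exprn_ge0// lerDr.
Qed.

Lemma sqrtrD_le (x y : R) : 0 <= x -> 0 <= y ->
  Num.sqrt (x + y) <= Num.sqrt x + Num.sqrt y.
Proof.
move=> x0 y0; rewrite -(@ler_pXn2r _ 2) ?nnegrE ?addr_ge0 ?sqrtr_ge0//.
rewrite sqrrD !sqr_sqrtr ?addr_ge0// -addrA [X in _ <= _ + X]addrC addrA lerDl.
by rewrite mulrn_wge0// mulr_ge0 ?sqrtr_ge0.
Qed.

(* The left-hand side is the number of blocks times the cardinal of the net times
   the failure probability of one vector. *)
Lemma union_bound_exponent (d w q p : nat) (r L A lN : R) :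
  let K := d%:R + (r + 1) * d%:R + (r + 1) + 18 * 20 ^+ d in
  0 < r -> 1 <= L -> L < p%:R -> q%:R <= 2 * p%:R / L ->
  w%:R <= 20 ^+ d * A -> 1 <= A -> lN <= A -> ln p%:R <= A ->
  (q ^ d)%:R * (2 ^+ (18 * w) * (2 * expR (- (K * A)))) <=
  2 * (L / p%:R) `^ (r * d%:R) * expR (- ((r + 1) * lN)).
Proof.
move=> K r0 L1 Lp qle wle A1 lNA lpA.
have L0 : 0 < L by lra.
have p0 : 0 < p%:R :> R by lra.
have pL0 : 0 < p%:R / L by rewrite divr_gt0.
have q2 : (q ^ d)%:R <= expR (d%:R * (1 + ln (p%:R / L))).
  rewrite natrX expRM_natl; apply: lerXn2r; rewrite ?nnegrE ?expR_ge0//.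
  apply: le_trans qle _; rewrite expRD lnK ?posrE// -mulrA ler_wpM2r ?(ltW pL0)//.
  by have := expR_ge1Dx (1 : R); lra.
have w2 : (2 : R) ^+ (18 * w) <= expR (18 * (20 ^+ d * A)).
  apply: (@le_trans _ _ (expR 1 ^+ (18 * w))).
    by apply: lerXn2r; rewrite ?nnegrE ?expR_ge0//; have := expR_ge1Dx (1 : R); lra.
  by rewrite -expRM_natl mulr1 ler_expR natrM ler_wpM2l.
have -> : (L / p%:R) `^ (r * d%:R) = expR (- (r * d%:R * ln (p%:R / L))).
  rewrite /powR gt_eqF ?divr_gt0// -invf_div lnV ?posrE// mulrN.
  by [].
have lpL : ln (p%:R / L) <= A.
  apply: le_trans lpA; rewrite ler_ln ?posrE// ler_pdivrMr// ler_peMr// ltW.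
have lpL0 : 0 <= ln (p%:R / L).
  by rewrite ln_ge0// ler_pdivlMr// mul1r ltW.
apply: (@le_trans _ _ (expR (d%:R * (1 + ln (p%:R / L))) *
    (expR (18 * (20 ^+ d * A)) * (2 * expR (- (K * A)))))).
  by apply: ler_pM => //; apply: ler_wpM2r.
rewrite !(mulrCA _ 2) -[leRHS]mulrA -!expRD; apply: ler_wpM2l => //; rewrite ler_expR.
have d0 : 0 <= d%:R :> R by [].
have h1 : d%:R * 1 <= d%:R * A by rewrite ler_wpM2l.
have h2 : (r + 1) * d%:R * ln (p%:R / L) <= (r + 1) * d%:R * A.
  by rewrite ler_wpM2l// mulr_ge0//; lra.
have h3 : (r + 1) * lN <= (r + 1) * A by rewrite ler_wpM2l//; lra.
(* The terms of [K] pay, in order, for the 2 in the bound on [q], for the powers of [p / L] in the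
   block count and in the conclusion, for the factor in [lN], and for the net. *)
rewrite /K; lra.
Qed.

End parameters.
(** If [N = 1], the sample condition with [C ln 2 > 1] forces [p = 1]; then [Omega] is a 1 by 1
    matrix, kappa is 1, and the block size is [ceil 0 = 0], which is excluded. *)
Lemma sample_size_gt1 (R : realType) (d p N : nat)
    (Omega : operator R (lattice d p)) (C : R) :
  (0 < d)%N -> (0 < p)%N -> (0 < N)%N -> posdef Omega -> 1 < C * ln 2 -> 0 < C ->
  C * (ln N%:R ^+ d + ln p%:R + ln (condition_number Omega) ^+ d) <= N%:R ->
  (0 < `|Num.ceil (ln (N%:R * condition_number Omega))|)%N -> (1 < N)%N.
Proof.
move=> d0 p0 N0 pO C2 C0 + b0; rewrite [(1 < N)%N]ltnNge => hN; apply/negP => N1.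
have {N0 N1} N1 : N = 1%N by apply/anti_leq/andP.
subst N; move: hN b0; rewrite mul1r ln1 expr0n (gtn_eqF d0) add0r => hN.
have k1 : 1 <= condition_number Omega.
  by apply: condition_number_ge1 => //; exact: lattice_card_gt0.
have p1 : p = 1%N.
  apply/anti_leq; rewrite p0 andbT leqNgt; apply/negP => p2.
  have : C * ln 2 <= 1; last by lra.
  apply: le_trans hN; rewrite ler_pM2l//; apply: (@le_trans _ _ (ln p%:R)).
    by rewrite ler_ln ?posrE ?ltr0n// ler_nat.
  by rewrite lerDl exprn_ge0// ln_ge0.
rewrite (condition_number_1x1 _ pO) ?ln1 ?ceil0//.
by rewrite card_ffun !card_ord p1 exp1n.
Qed.

Lemma nblocks_le (R : realType) (p b : nat) (L : R) :
  (0 < b)%N -> 0 < L -> L <= b%:R -> (b <= p)%N ->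
  (nblocks p b)%:R <= 2 * p%:R / L.
Proof.
move=> b0 L0 Lb bp; rewrite ler_pdivlMr//.
apply: (@le_trans _ _ ((nblocks p b)%:R * b%:R)); first by rewrite ler_wpM2l.
rewrite -!natrM ler_nat; apply: leq_trans (leq_trunc_div _ _) _; lia.
Qed.

Theorem theorem2p8 (R : realType) (d : nat) (r : R) :
  (0 < d)%N -> 0 < r ->
  exists C1 C2 : R,
    [/\ 0 < C1, 0 < C2 &
      forall (p N : nat) (Omega : operator R (lattice d p))
        (disp : measure_display) (T : measurableType disp)
        (P : probability T R) (Z : 'I_N -> lattice d p -> {RV P >-> R}),
      let kappa := condition_number Omega in
      let b := `|Num.ceil (ln (N%:R * kappa))|%N in
      (0 < p)%N -> (0 < N)%N ->
      decay_class Omega ->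
      iid_gaussian (invmx Omega) Z ->
      C1 * (ln N%:R ^+ d + ln p%:R + ln kappa ^+ d) <= N%:R ->
      ln (N%:R * kappa) < p%:R ->
      (0 < b)%N ->
      ((1 - 2 * (ln (N%:R * kappa) / p%:R) `^ (r * d%:R)
              * expR (- ((r + 1) * ln N%:R ^+ d)))%:E <=
       P [set w | let z := fun n t => Z n t w in
            (well_defined b z /\
             opnorm (Omega_hat b z - Omega) / opnorm Omega <=
               C2 * (Num.sqrt (ln N%:R ^+ d / N%:R) +
                     Num.sqrt (ln p%:R / N%:R) +
                     Num.sqrt (ln kappa ^+ d / N%:R)))%R]%classic)%E].
Proof.
move=> d0 r0.
pose K : R := d%:R + (r + 1) * d%:R + (r + 1) + 18 * 20 ^+ d.
have K1 : 1 <= K.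
  have : 0 <= (r + 1) * d%:R by rewrite mulr_ge0//; lra.
  have : 0 <= 20 ^+ d :> R by rewrite exprn_ge0.
  have : 0 <= d%:R :> R by [].
  by rewrite /K; lra.
have ln2 : 0 < ln 2 :> R by rewrite ln_gt0// ltr1n.
have ln2d : 0 < (ln 2 : R) ^+ d by rewrite exprn_gt0.
(* The first term makes [t^2 = 16 K A / N] at most 1/36, so that [3 t <= 1/2]; the second gives
   [N >= e], that is [ln N >= 1]; the third excludes [N = 1]. *)
pose C1 : R := 576 * K + expR 1 / ln 2 ^+ d + 2 / ln 2.
have c1 : 0 < expR 1 / (ln 2 : R) ^+ d by rewrite divr_gt0 ?expR_gt0.
have c2 : 0 < 2 / (ln 2 : R) by rewrite divr_gt0.
have C10 : 0 < C1 by rewrite /C1; lra.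
(* With [e = 3 t] and [1 / N <= t], the relative error is at most [14 * 3^d * t], and [t] is at most
   [4 sqrt K] times the rate; 64 exceeds 56. *)
exists C1, (64 * 3 ^+ d * Num.sqrt K); split => //.
  by rewrite !mulr_gt0 ?exprn_gt0// sqrtr_gt0; lra.
move=> p N Omega disp T P Z kappa b p0 N0 dec gZ hN Lp b0.
have pO : posdef Omega := proj1 dec.
have n0 := lattice_card_gt0 d p0.
have om0 := posdef_opnorm_gt0 n0 pO.
have k1 : 1 <= kappa := condition_number_ge1 n0 pO.
have lk0 : 0 <= ln kappa by rewrite ln_ge0.
have lp0 : 0 <= ln p%:R :> R by rewrite ln_ge0// ler1n.
have N1 : (1 < N)%N.
  apply: (sample_size_gt1 (C := C1) d0 p0 N0 pO) => //.
  have : 2 / ln 2 * ln 2 <= C1 * ln 2 by rewrite ler_pM2r// /C1; lra.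
  by rewrite divfK ?gt_eqF//; lra.
have N0R : 0 < N%:R :> R by rewrite ltr0n.
have lN0 : 0 <= ln N%:R :> R by rewrite ln_ge0// ler1n.
pose A := ln N%:R ^+ d + ln p%:R + ln kappa ^+ d.
have lNd0 : 0 <= ln N%:R ^+ d :> R by rewrite exprn_ge0.
have lkd0 : 0 <= ln kappa ^+ d by rewrite exprn_ge0.
have lN1 : 1 <= ln N%:R :> R.
  have lN2 : ln 2 ^+ d <= A.
    apply: (@le_trans _ _ (ln N%:R ^+ d)); last by rewrite /A; lra.
    apply: lerXn2r; rewrite ?nnegrE ?(ltW ln2)//.
    by rewrite ler_ln ?posrE// ler_nat.
  rewrite -[leLHS]expRK ler_ln ?posrE ?expR_gt0//.
  apply: le_trans hN; rewrite -/A.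
  apply: (@le_trans _ _ (expR 1 / ln 2 ^+ d * ln 2 ^+ d)).
    by rewrite divfK ?gt_eqF.
  by apply: ler_pM => //; rewrite ?ltW// /C1; lra.
have lNd1 : 1 <= ln N%:R ^+ d :> R by rewrite exprn_ege1.
have A1 : 1 <= A by rewrite /A; lra.
set L := ln (N%:R * kappa) in Lp *.
have LE : L = ln N%:R + ln kappa by rewrite /L lnM ?posrE//; lra.
have L1 : 1 <= L by rewrite LE; lra.
have bE : b%:R = (Num.ceil L)%:~R :> R.
  by rewrite /b -/L natr_absz ger0_norm// ceil_ge0; lra.
have Lb : L <= b%:R by rewrite bE ceil_ge.
have bL : b%:R <= 2 * L.
  by have := ceil_itv L; rewrite bE => /andP[h _]; rewrite intrB in h; lra.
have bp : (b <= p)%N.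
  rewrite -(ler_nat R) bE -[p%:R]/(p%:Z%:~R) ler_int ceil_le_int.
  exact: ltW.
have NkapO : N%:R * kappa <= expR b%:R.
  by rewrite -[leLHS]lnK ?ler_expR// posrE mulr_gt0//; lra.
(* Chosen so that the chi-square exponent [N t^2 / 16] equals [K A]. *)
pose t := Num.sqrt (16 * K * A / N%:R).
have tt : t ^+ 2 = 16 * K * A / N%:R.
  by rewrite sqr_sqrtr// divr_ge0// !mulr_ge0//; lra.
have t0 : 0 <= t by exact: sqrtr_ge0.
have t6 : t <= 6^-1.
  rewrite -(@ler_pXn2r _ 2) ?nnegrE// tt ler_pdivrMr//.
  have : 576 * K * A <= C1 * A by rewrite ler_wpM2r// /C1; lra.
  by rewrite /A in hN *; lra.
(* The bias, of order [1 / N], is absorbed by the random error because [K A >= 1]. *)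
have Nt1 : N%:R^-1 <= t.
  rewrite -(@ler_pXn2r _ 2) ?nnegrE ?invr_ge0// tt expr2 ler_wpM2r ?invr_ge0//.
  have : N%:R^-1 <= 1 :> R by rewrite invf_le1// ler1n.
  have : 1 * 1 <= K * A by apply: ler_pM.
  by lra.
(* Here [20 = 5 * 4]: five blocks per direction, and [b^d <= (2 L)^d <= 4^d A] once the two
   logarithms in [L] are separated. *)
have w_le (j : block_index d p b) : #|window j|%:R <= 20 ^+ d * A.
  have := card_window j; rewrite -(ler_nat R) natrM !natrX => /le_trans; apply.
  have h : b%:R ^+ d <= 4 ^+ d * A.
    apply: (@le_trans _ _ ((2 * L) ^+ d)).
      by apply: lerXn2r; rewrite ?nnegrE//; lra.
    rewrite exprMn (_ : 4 = 2 * 2) ?exprMn; last by ring.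
    rewrite -mulrA ler_wpM2l ?exprn_ge0// LE.
    by apply: le_trans (exprD_le_double _ _ _) _ => //; rewrite ler_wpM2l// /A; lra.
  rewrite (_ : 20 = 5 * 4) ?exprMn; last by ring.
  by rewrite -mulrA ler_wpM2l ?exprn_ge0.
have t2 : t <= 2 by lra.
(* One integer bounding all window sizes, so that the failure probability [c] does not depend on the
   block. *)
pose w := Num.truncn (20 ^+ d * A).
have wA : w%:R <= 20 ^+ d * A by rewrite truncn_le// mulr_ge0 ?exprn_ge0//; lra.
pose c : R := 2 ^+ (18 * w) * (2 * expR (- (K * A))).
have Nt : N%:R * t ^+ 2 / 16 = K * A by rewrite tt; field; rewrite gt_eqF.
have /choice[Bad badP] (j : block_index d p b) : exists B : set T,
    [/\ measurable B, (P B <= c%:E)%E & forall x, ~ B x -> forall u,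
      `|dotp u ((local_cov (fun n t => Z n t x) j -
        sel R (window j) *m invmx Omega *m (sel R (window j))^T) *m u)| <=
      3 * t * dotp u (sel R (window j) *m invmx Omega *m (sel R (window j))^T *m u)].
  have [B [mB PB] hB] := local_cov_concentration p0 N0 pO gZ j t0 t2.
  exists B; split => //; apply: le_trans PB _; rewrite lee_fin Nt /c.
  apply: ler_wpM2r; first by rewrite mulr_ge0 ?expR_ge0.
  rewrite ler_eXn2l ?ltr1n// leq_mul2l /= truncn_ge_nat ?w_le//.
  by rewrite mulr_ge0 ?exprn_ge0//; lra.
pose S := Num.sqrt (ln N%:R ^+ d / N%:R) + Num.sqrt (ln p%:R / N%:R) +
  Num.sqrt (ln kappa ^+ d / N%:R).
have tS : t <= 4 * Num.sqrt K * S.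
  have -> : t = 4 * Num.sqrt K * Num.sqrt (A / N%:R).
    have -> : 4 = Num.sqrt (4 ^+ 2) :> R by rewrite sqrtr_sqr ger0_norm.
    rewrite /t -!sqrtrM ?mulr_ge0 ?sqr_ge0//; last by lra.
    by congr Num.sqrt; rewrite !mulrA; congr (_ * _ * _ / _); ring.
  rewrite ler_wpM2l ?mulr_ge0 ?sqrtr_ge0// /A !mulrDl.
  apply: le_trans (sqrtrD_le _ _) _; rewrite ?addr_ge0 ?divr_ge0//.
  by rewrite lerD2r; apply: sqrtrD_le; rewrite divr_ge0.
pose E := [set x | well_defined b (fun n t => Z n t x) /\
  opnorm (Omega_hat b (fun n t => Z n t x) - Omega) <=
    64 * 3 ^+ d * Num.sqrt K * S * opnorm Omega]%classic.
have mE : measurable E by apply: measurable_estimator_event.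
have mBad j : measurable (Bad j) by have [] := badP j.
pose U := (\big[setU/set0]_(j : block_index d p b) Bad j)%classic.
have mU : measurable U by apply: bigsetU_measurable => j _.
have goodE : (~` U `<=` E)%classic.
  move=> x nU.
  have e0 : 0 <= 3 * t by rewrite mulr_ge0.
  have e2 : 3 * t <= 2^-1 by lra.
  have loc j : ~ Bad j x by move=> Bx; apply: nU; rewrite /U (bigD1 j)//=; left.
  have [wd err] := estimator_error p0 N0 b0 dec NkapO e0 e2
    (fun j => let: And3 _ _ h := badP j in h x (loc j)).
  split=> //; apply: le_trans err _; rewrite mulrC ler_wpM2r ?opnorm_ge0//.
  have d1 : 1 <= 3 ^+ d :> R by rewrite exprn_ege1// ler1n.
  have dt : t * 1 <= t * 3 ^+ d by rewrite ler_wpM2l.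
  have dS : 3 ^+ d * t <= 3 ^+ d * (4 * Num.sqrt K * S) by rewrite ler_wpM2l//; lra.
  have dN : 3 ^+ d * N%:R^-1 <= 3 ^+ d * t by rewrite ler_wpM2l//; lra.
  rewrite invfM; lra.
have -> : [set x | let z := fun n t => Z n t x in
    (well_defined b z /\ opnorm (Omega_hat b z - Omega) / opnorm Omega <=
      64 * 3 ^+ d * Num.sqrt K * S)%R]%classic = E.
  by apply/seteqP; split => x /= [wd]; rewrite ler_pdivrMr.
apply: (@le_trans _ _ (P (~` U)%classic)); last first.
  by apply: le_measure; rewrite ?inE//; exact: measurableC.
rewrite probability_setC// EFinB; apply: leeB => //.
apply: le_trans (measure_bigcup_finset_le mBad (D := predT) (c := c) _) _.
  by move=> j _; have [] := badP j.
rewrite lee_fin cardT -cardE card_ffun !card_ord.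
have L0 : 0 < L by lra.
apply: (@union_bound_exponent R d w _ p r L A (ln N%:R ^+ d)) => //.
- exact: nblocks_le.
- by rewrite /A; lra.
- by rewrite /A; lra.
Qed.
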